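(* The Lie algebra $\mathbf g=\mathfrak{sl}_3(\mathbb R)$ is reductive with a $3$-dimensional subalgebra $\mathbf h$ and a $5$-dimensional complementary subspace $\mathbf m$ generating $\mathbf g$, up to conjugation, in precisely one of the following cases: 1) $\mathbf h_6=\langle e_1-e_3,e_2-e_4,e_7-e_6\rangle\cong\mathfrak{so}_3(\mathbb R)$, $\mathbf m_6=\langle e_5,e_8,e_1+e_3,e_2+e_4,e_7+e_6\rangle$; 2) $\mathbf h_7=\langle e_1+e_3,e_2+e_4,e_6-e_7\rangle$, $\mathbf m_7=\langle e_5,e_8,e_1-e_3,e_2-e_4,e_7+e_6\rangle$; 3) $\mathbf h_8=\langle e_5-e_8,e_6,e_7\rangle$, $\mathbf m_8=\langle e_1,e_2,e_3,e_4,e_5+e_8\rangle$. Both Lie algebras $\mathbf h_7$ and $\mathbf h_8$ are isomorphic to $\mathfrak{sl}_2(\mathbb R)$.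
   Context: $\mathbf g=\mathfrak{sl}_3(\mathbb R)$ has the basis $e_1,\dots,e_8$ determined by $$\sum_{i=1}^8\lambda_i e_i=\begin{pmatrix}-\lambda_5-\lambda_8&\lambda_1&\lambda_2\\ \lambda_3&\lambda_5&\lambda_6\\ \lambda_4&\lambda_7&\lambda_8\end{pmatrix},\qquad\lambda_i\in\mathbb R.$$ $\langle\cdots\rangle$ denotes the real linear span. $\mathbf g$ is reductive with $\mathbf h$ and $\mathbf m$ if $\mathbf h$ is a subalgebra, $\mathbf m$ is a subspace, $\mathbf g=\mathbf m\oplus\mathbf h$ and $[\mathbf h,\mathbf m]\subseteq\mathbf m$. ''$\mathbf m$ generates $\mathbf g$'' means generation as a Lie algebra. ''Up to conjugation'' means that the pair $(\mathbf h,\mathbf m)$ may be replaced by its image under $Ad_g$, $g\in SL_3(\mathbb R)$. *)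

(* Defs.v *)
From HB Require Import structures.
From mathcomp Require Import all_boot all_order all_algebra.

Set Implicit Arguments.
Unset Strict Implicit.
Unset Printing Implicit Defensive.

Import Order.TTheory GRing.Theory Num.Theory.
Local Open Scope ring_scope.

Definition lie_bracket (F : fieldType) (n : nat) (x y : 'M[F]_n) : 'M[F]_n :=
  x *m y - y *m x.

Definition lie_subalgebra (F : fieldType) (n : nat) (h : {vspace 'M[F]_n}) : Prop :=
  {in h &, forall x y, lie_bracket x y \in h}.

(* [g] is the smallest Lie subalgebra containing [m] (for [g] a subalgebra). *)
Definition lie_generates (F : fieldType) (n : nat) (m g : {vspace 'M[F]_n}) : Prop :=
  (m <= g)%VS /\
  forall k : {vspace 'M[F]_n}, lie_subalgebra k -> (m <= k)%VS -> (g <= k)%VS.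

(* A linear map on a subspace always extends to the ambient matrix space, so an
   isomorphism is given by an ambient linear map, constrained only on [h]. *)
Definition lie_isomorphic (F : fieldType) (n p : nat)
    (h : {vspace 'M[F]_n}) (k : {vspace 'M[F]_p}) : Prop :=
  exists f : 'Hom('M[F]_n, 'M[F]_p),
    [/\ (h :&: lker f = 0)%VS, (f @: h = k)%VS &
        {in h &, forall x y, f (lie_bracket x y) = lie_bracket (f x) (f y)}].

Definition sl (F : fieldType) (n : nat) : {vspace 'M[F]_n} :=
  lker (linfun (fun x : 'M[F]_n => \tr x : F^o)).

Lemma memv_sl (F : fieldType) (n : nat) (x : 'M[F]_n) :
  (x \in sl F n) = (\tr x == 0).
Proof. by rewrite memv_ker lfunE. Qed.

Definition so (F : fieldType) (n : nat) : {vspace 'M[F]_n} :=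
  lker (linfun (fun x : 'M[F]_n => x^T + x)).

Lemma memv_so (F : fieldType) (n : nat) (x : 'M[F]_n) :
  (x \in so F n) = (x^T == - x).
Proof.
have lin : linear (fun x : 'M[F]_n => x^T + x).
  by move=> a u v; rewrite linearP /= scalerDr addrACA.
pose L := GRing.isLinear.Build _ _ _ _ _ lin.
pose f : {linear 'M[F]_n -> 'M[F]_n} := HB.pack (fun x : 'M[F]_n => x^T + x) L.
by rewrite memv_ker (lfunE f) addr_eq0.
Qed.

Definition reductive_pair (F : fieldType) (n : nat)
    (g h m : {vspace 'M[F]_n}) : Prop :=
  [/\ lie_subalgebra h, (m + h = g)%VS, (m :&: h = 0)%VS &
      forall x y, x \in h -> y \in m -> lie_bracket x y \in m].

Definition Ad (F : fieldType) (n : nat) (g x : 'M[F]_n) : 'M[F]_n :=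
  g *m x *m invmx g.

Lemma Ad_is_linear (F : fieldType) (n : nat) (g : 'M[F]_n) : linear (Ad g).
Proof. by move=> a u v; rewrite /Ad mulmxDr -scalemxAr mulmxDl -scalemxAl. Qed.

HB.instance Definition _ (F : fieldType) (n : nat) (g : 'M[F]_n) :=
  GRing.isLinear.Build F 'M[F]_n 'M[F]_n _ (Ad g) (Ad_is_linear g).

Definition SL_conjugate (F : fieldType) (n : nat)
    (h m h' m' : {vspace 'M[F]_n}) : Prop :=
  exists g : 'M[F]_n,
    [/\ \det g = 1, (linfun (Ad g) @: h = h')%VS & (linfun (Ad g) @: m = m')%VS].

Definition sl3_mx (F : fieldType) (l : nat -> F) : 'M[F]_3 :=
  \matrix_(i, j)
    nth 0 (nth [::]
      [:: [:: - l 5%N - l 8%N; l 1%N; l 2%N];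
          [:: l 3%N;           l 5%N; l 6%N];
          [:: l 4%N;           l 7%N; l 8%N]] i) j.

(* The basis is indexed from 1 to 8. *)
Definition e (F : fieldType) (k : nat) : 'M[F]_3 :=
  sl3_mx (fun i => (i == k)%:R).

Lemma sl3_mx_sum (F : fieldType) (l : nat -> F) :
  \sum_(1 <= i < 9) l i *: e F i = sl3_mx l.
Proof.
apply/matrixP=> i j; rewrite summxE /index_iota /= !big_cons big_nil !mxE.
by case: i j => [[|[|[|//]]] ?] [[|[|[|//]]] ?] /=;
  rewrite ?(mulr1, mulr0, oppr0, subr0, sub0r, mulrN, addr0, add0r).
Qed.

Definition h6 (F : fieldType) : {vspace 'M[F]_3} :=
  span [:: e F 1 - e F 3; e F 2 - e F 4; e F 7 - e F 6].
Definition m6 (F : fieldType) : {vspace 'M[F]_3} :=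
  span [:: e F 5; e F 8; e F 1 + e F 3; e F 2 + e F 4; e F 7 + e F 6].

Definition h7 (F : fieldType) : {vspace 'M[F]_3} :=
  span [:: e F 1 + e F 3; e F 2 + e F 4; e F 6 - e F 7].
Definition m7 (F : fieldType) : {vspace 'M[F]_3} :=
  span [:: e F 5; e F 8; e F 1 - e F 3; e F 2 - e F 4; e F 7 + e F 6].

Definition h8 (F : fieldType) : {vspace 'M[F]_3} :=
  span [:: e F 5 - e F 8; e F 6; e F 7].
Definition m8 (F : fieldType) : {vspace 'M[F]_3} :=
  span [:: e F 1; e F 2; e F 3; e F 4; e F 5 + e F 8].

(* Main.v *)
From HB Require Import structures.
Require Import Defs.
From mathcomp Require Import all_boot all_order all_algebra reals boolp.
From mathcomp Require Import ring lra.

Set Implicit Arguments.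
Unset Strict Implicit.
Unset Printing Implicit Defensive.

Import Order.TTheory GRing.Theory Num.Theory.
Local Open Scope ring_scope.

(** Let [h] be a 3-dimensional subalgebra of [sl_3] with an invariant complement
    [m].  The projection [p] of [sl_3] onto [h] along [m] commutes with the
    action of [h], and everything hinges on whether [h] contains a nonzero
    nilpotent matrix [z].

    If it does, complete [z] to an sl(2)-triple [(z, t, f)] of [sl_3]
    ([jacobson_morozov]).  Equivariance carries the relations [[z, f] = t] and
    [[t, z] = 2 z] over to [p t] and [p f] ([reductive_projected_pair]), and in
    dimension three this already makes [h] the span of an sl(2)-triple
    ([reductive_triple]); solvable subalgebras are thereby excluded without any
    structure theory.  A triple is determined up to conjugation by whether
    [z ^ 2] vanishes ([sl2_triple_normal_reg], [sl2_triple_normal_min]).  Both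
    [h7] and [h8] are spanned by such a triple, one of each sort, so [h] is
    conjugate to one of them.

    If it does not, any relation in [h] that forces an element to be nilpotent
    forces it to vanish.  For instance [[x, y] = c y] with [c != 0] does, because
    then all the traces [tr (y ^ k)] are zero.  A commuting [h] is impossible
    ([abelian_nilpotent]), and for a noncommuting pair [x, y] in [h] the map
    [ad x] has to be a rotation of a plane complementary to [x]
    ([exists_rotation]).  The sign of the remaining structure constant decides
    between so(3) and sl(2), and sl(2) contains nilpotent elements; hence [h] is
    spanned by an so(3)-triple ([exists_so3_triple]).  A nonzero real 3 by 3
    representation of so(3) is the standard one ([so3_normal_form]), so [h] is conjugate to [h6].

    In each model a Casimir operator acts on [h] by a scalar that is not one of
    its eigenvalues on the listed complement, so that this complement is the only
    invariant one ([casimir_mem]).  Conjugations by invertible matrices can be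
    replaced by conjugations of determinant 1, since every real number has a cube
    root ([SL_of_GL]).

    Two invariants separate the models: only [h8] contains a nonzero matrix of
    square zero, and [h7], unlike [h6], contains a matrix whose square has
    positive trace. *)

(** * Explicit three by three matrices *)

Definition mx3 (F : fieldType) (a b c d e f g h i : F) : 'M[F]_3 :=
  \matrix_(x, y) nth 0 (nth [::] [:: [:: a; b; c]; [:: d; e; f]; [:: g; h; i]] x) y.

Section Mx3.
Variable F : fieldType.
Implicit Types (A B C x y z : 'M[F]_3).

Lemma mx3_eta A : exists a b c d e f g h i, A = mx3 a b c d e f g h i.
Proof.
exists (A 0 0), (A 0 1), (A 0 (inord 2)), (A 1 0), (A 1 1), (A 1 (inord 2)).
exists (A (inord 2) 0), (A (inord 2) 1), (A (inord 2) (inord 2)).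
apply/matrixP=> i j; rewrite mxE.
case: i j => [[|[|[|//]]] ?] [[|[|[|//]]] ?] /=;
  by congr (A _ _); apply/val_inj; rewrite /= ?inordK.
Qed.

Lemma mx3_inj a b c d e f g h i a' b' c' d' e' f' g' h' i' :
  mx3 a b c d e f g h i = mx3 a' b' c' d' e' f' g' h' i' :> 'M[F]_3 ->
  (a = a' /\ b = b' /\ c = c') /\ (d = d' /\ e = e' /\ f = f') /\
  (g = g' /\ h = h' /\ i = i').
Proof.
move=> /matrixP E.
have P k l : mx3 a b c d e f g h i (inord k) (inord l)
   = mx3 a' b' c' d' e' f' g' h' i' (inord k) (inord l) by apply: E.
move: (P 0%N 0%N) (P 0%N 1%N) (P 0%N 2%N) (P 1%N 0%N) (P 1%N 1%N) (P 1%N 2%N)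
  (P 2%N 0%N) (P 2%N 1%N) (P 2%N 2%N).
by rewrite !mxE !inordK.
Qed.

Lemma mul_mx3 a b c d e f g h i a' b' c' d' e' f' g' h' i' :
  mx3 a b c d e f g h i *m mx3 a' b' c' d' e' f' g' h' i' =
  mx3 (a * a' + b * d' + c * g') (a * b' + b * e' + c * h') (a * c' + b * f' + c * i')
      (d * a' + e * d' + f * g') (d * b' + e * e' + f * h') (d * c' + e * f' + f * i')
      (g * a' + h * d' + i * g') (g * b' + h * e' + i * h') (g * c' + h * f' + i * i')
  :> 'M[F]_3.
Proof.
apply/matrixP=> x y; rewrite !mxE !big_ord_recl big_ord0 !mxE /= addr0 addrA.
by case: x y => [[|[|[|//]]] ?] [[|[|[|//]]] ?].
Qed.

Lemma add_mx3 a b c d e f g h i a' b' c' d' e' f' g' h' i' :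
  mx3 a b c d e f g h i + mx3 a' b' c' d' e' f' g' h' i' =
  mx3 (a + a') (b + b') (c + c') (d + d') (e + e') (f + f') (g + g') (h + h') (i + i')
  :> 'M[F]_3.
Proof.
by apply/matrixP=> x y; rewrite !mxE; case: x y => [[|[|[|//]]] ?] [[|[|[|//]]] ?].
Qed.

Lemma opp_mx3 a b c d e f g h i :
  - mx3 a b c d e f g h i =
  mx3 (- a) (- b) (- c) (- d) (- e) (- f) (- g) (- h) (- i) :> 'M[F]_3.
Proof.
by apply/matrixP=> x y; rewrite !mxE; case: x y => [[|[|[|//]]] ?] [[|[|[|//]]] ?].
Qed.

Lemma scale_mx3 k a b c d e f g h i :
  k *: mx3 a b c d e f g h i =
  mx3 (k * a) (k * b) (k * c) (k * d) (k * e) (k * f) (k * g) (k * h) (k * i) :> 'M[F]_3.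
Proof.
by apply/matrixP=> x y; rewrite !mxE; case: x y => [[|[|[|//]]] ?] [[|[|[|//]]] ?].
Qed.

Lemma zero_mx3 : 0 = mx3 0 0 0 0 0 0 0 0 0 :> 'M[F]_3.
Proof.
by apply/matrixP=> x y; rewrite !mxE; case: x y => [[|[|[|//]]] ?] [[|[|[|//]]] ?].
Qed.

Lemma scalar_mx3 k : k%:M = mx3 k 0 0 0 k 0 0 0 k :> 'M[F]_3.
Proof.
by apply/matrixP=> x y; rewrite !mxE; case: x y => [[|[|[|//]]] ?] [[|[|[|//]]] ?].
Qed.

Lemma tr_mx3 a b c d e f g h i : \tr (mx3 a b c d e f g h i) = a + e + i :> F.
Proof. by rewrite /mxtrace !big_ord_recl big_ord0 !mxE /= addr0 addrA. Qed.

Lemma sl3_mxE (l : nat -> F) : sl3_mx l =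
  mx3 (- l 5%N - l 8%N) (l 1%N) (l 2%N) (l 3%N) (l 5%N) (l 6%N) (l 4%N) (l 7%N) (l 8%N).
Proof. by []. Qed.

Definition mx3E := (mul_mx3, add_mx3, opp_mx3, scale_mx3, tr_mx3, zero_mx3).

End Mx3.

(** The Cayley-Hamilton identity of a traceless matrix is cubic; this is its
    part of bidegree (2, 1). *)
Lemma CH_polarized (F : fieldType) (y z : 'M[F]_3) : \tr y = 0 -> \tr z = 0 ->
  2 *: (y *m y *m z + y *m z *m y + z *m y *m y) =
  \tr (y *m y) *: z + (2 * \tr (y *m z)) *: y + (2 * \tr (y *m y *m z))%:M.
Proof.
have [a [b [c [d [e [f [g [h [i ->]]]]]]]]] := mx3_eta y.
have [a' [b' [c' [d' [e' [f' [g' [h' [i' ->]]]]]]]]] := mx3_eta z.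
rewrite !mx3E => E E'.
have -> : i = - a - e by rewrite -[RHS]add0r -E; ring.
have -> : i' = - a' - e' by rewrite -[RHS]add0r -E'; ring.
rewrite scalar_mx3 !mx3E.
congr mx3; ring.
Qed.

(** * Brackets, bases and nilpotency *)

Notation "[ 'lie' x , y ]" := (lie_bracket x y) (format "[ 'lie'  x ,  y ]").

Section Bracket.
Variables (F : fieldType) (n : nat).
Implicit Types (x y z w : 'M[F]_n).

Lemma lieC x y : [lie x, y] = - [lie y, x].
Proof. by rewrite /lie_bracket opprB. Qed.

Lemma liexx x : [lie x, x] = 0.
Proof. exact: subrr. Qed.

Lemma lieDr x y z : [lie x, y + z] = [lie x, y] + [lie x, z].
Proof. by rewrite /lie_bracket mulmxDr mulmxDl opprD addrACA. Qed.

Lemma lieZr k x y : [lie x, k *: y] = k *: [lie x, y].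
Proof. by rewrite /lie_bracket -scalemxAr -scalemxAl -scalerBr. Qed.

Lemma lieNr x y : [lie x, - y] = - [lie x, y].
Proof. by rewrite -scaleN1r lieZr scaleN1r. Qed.

Lemma lie0r x : [lie x, 0] = 0.
Proof. by rewrite /lie_bracket mulmx0 mul0mx subrr. Qed.

Lemma lieDl x y z : [lie x + y, z] = [lie x, z] + [lie y, z].
Proof. by rewrite lieC lieDr opprD -!lieC. Qed.

Lemma lieZl k x y : [lie k *: x, y] = k *: [lie x, y].
Proof. by rewrite lieC lieZr -scalerN -lieC. Qed.

Lemma lieNl x y : [lie - x, y] = - [lie x, y].
Proof. by rewrite -scaleN1r lieZl scaleN1r. Qed.

Lemma lie0l x : [lie 0, x] = 0.
Proof. by rewrite lieC lie0r oppr0. Qed.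

Lemma lieJ x y z : [lie x, [lie y, z]] = [lie [lie x, y], z] + [lie y, [lie x, z]].
Proof.
rewrite /lie_bracket !mulmxBr !mulmxBl !mulmxA !opprB !addrA.
set a := x *m y *m z; set b := x *m z *m y; set c := y *m z *m x.
set d := z *m y *m x; set u := y *m x *m z; set v := z *m x *m y.
by apply/matrixP=> i j; rewrite !mxE; ring.
Qed.

Lemma lie_mulr x y z : [lie x, y *m z] = [lie x, y] *m z + y *m [lie x, z].
Proof. by rewrite /lie_bracket !mulmxBr !mulmxBl !mulmxA addrA subrK. Qed.

Lemma lie_eq0 x y : [lie x, y] = 0 -> x *m y = y *m x.
Proof. exact: subr0_eq. Qed.

Lemma tr_lie x y : \tr [lie x, y] = 0.
Proof. by rewrite /lie_bracket raddfB /= mxtrace_mulC subrr. Qed.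

(** The trace is invariant: moving [x] to the other side turns the bracket
    of [x] and [y] into the bracket of [y] and [w]. *)
Lemma tr_lie_mul_comm x y w : y *m w = w *m y -> \tr ([lie x, y] *m w) = 0.
Proof.
by move=> E; rewrite /lie_bracket mulmxBl raddfB /= -!mulmxA E (mxtrace_mulC y)
  -mulmxA subrr.
Qed.

End Bracket.

Definition lieE := (lieDr, lieDl, lieZr, lieZl, lieNr, lieNl, liexx, lie0r, lie0l).

(* Linear identities between matrices are checked entry by entry. *)
Ltac mxring := apply/matrixP=> ? ?; rewrite !mxE; ring.
Ltac mxfield := apply/matrixP=> ? ?; rewrite !mxE; field.

Section Basis3.
Variables (F : fieldType) (V : vectType F).
Implicit Types (x y z w : V) (h : {vspace V}).

Definition indep3 x y z :=
  forall a b c, a *: x + b *: y + c *: z = 0 -> [/\ a = 0, b = 0 & c = 0].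

Lemma indep3_free x y z : indep3 x y z -> free [:: x; y; z].
Proof.
move=> ind; rewrite -[[:: x; y; z]]/(tval [tuple x; y; z]); apply/freeP=> k.
rewrite !big_ord_recl big_ord0 /= addr0 addrA => /ind [k0 k1 k2].
case=> [[|[|[|//]]] lt]; [rewrite -[RHS]k0|rewrite -[RHS]k1|rewrite -[RHS]k2];
  by congr (k _); apply/val_inj.
Qed.

Lemma span3P x y z w :
  reflect (exists a b c, w = a *: x + b *: y + c *: z) (w \in <<[:: x; y; z]>>%VS).
Proof.
rewrite !span_cons span_nil addv0; apply: (iffP idP).
  move/memv_addP=> [_ /vlineP[a ->] [_ /memv_addP[_ /vlineP[b ->] [_ /vlineP[c ->] ->]] ->]].
  by exists a, b, c; rewrite addrA.
move=> [a [b [c ->]]]; rewrite -addrA.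
by apply: memv_add; rewrite ?memvZ ?memv_line //; apply: memv_add; rewrite memvZ ?memv_line.
Qed.

Lemma span3_eq h x y z : \dim h = 3 -> x \in h -> y \in h -> z \in h ->
  indep3 x y z -> h = <<[:: x; y; z]>>%VS.
Proof.
move=> dh hx hy hz ind; apply/esym/eqP; rewrite eqEdim dh.
have /eqP -> := indep3_free ind; rewrite leqnn andbT.
by apply/span_subvP=> w; rewrite !inE => /or3P[] /eqP->.
Qed.

End Basis3.

Section Nilpotency.
Variable F : numFieldType.
Implicit Types x y z : 'M[F]_3.

(** For a traceless matrix the coefficients of the characteristic polynomial are
    expressed by the traces of the square and of the cube. *)
Lemma CH3 y : \tr y = 0 ->
  6 *: (y *m y *m y) = (3 * \tr (y *m y)) *: y + (2 * \tr (y *m y *m y))%:M.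
Proof.
move=> ty; have := CH_polarized ty ty.
set u := (2 * \tr (y *m y *m y))%:M; set k := \tr (y *m y); set w := y *m y *m y => E.
move: u k w E => u k w E.
transitivity (2 *: (w + w + w)); first by mxring.
by rewrite E; mxring.
Qed.

Lemma nilp_of_traces y : \tr y = 0 -> \tr (y *m y) = 0 -> \tr (y *m y *m y) = 0 ->
  y *m y *m y = 0.
Proof.
move=> t1 t2 t3; have := CH3 t1; rewrite t2 t3 !mulr0 scale0r add0r.
by rewrite -scalemx1 scale0r => /eqP; rewrite scaler_eq0 pnatr_eq0 => /eqP.
Qed.

(** Every power [w] of [y] commutes with [y], so that
    [c * tr (y w) = tr ([x, y] w)] is zero. *)
Lemma nilp_eigen x y c : c != 0 -> [lie x, y] = c *: y -> y *m y *m y = 0.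
Proof.
move=> c0 E.
have H w : y *m w = w *m y -> \tr (y *m w) = 0.
  move/(tr_lie_mul_comm x); rewrite E -scalemxAl linearZ /= => /eqP.
  by rewrite mulf_eq0 (negPf c0) => /eqP.
apply: nilp_of_traces; first by rewrite -[y]mulmx1 H // mulmx1 mul1mx.
  exact: H.
by rewrite -mulmxA H ?mulmxA.
Qed.

(** This is Jacobson's lemma: the powers of [z] commute with [x], so their traces
    vanish by invariance. *)
Lemma nilp_jacobson x y z : [lie x, y] = z -> [lie x, z] = 0 -> z *m z *m z = 0.
Proof.
move=> E /lie_eq0 C.
have H w : x *m w = w *m x -> \tr (z *m w) = 0.
  by move/(tr_lie_mul_comm y); rewrite lieC E mulNmx raddfN => /eqP; rewrite oppr_eq0 => /eqP.
apply: nilp_of_traces; first by rewrite -[z]mulmx1 H // mulmx1 mul1mx.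
  exact: H.
by rewrite -mulmxA H // mulmxA C -!mulmxA C.
Qed.

End Nilpotency.

(** * Commuting families of traceless matrices *)

Lemma memv_slP (F : fieldType) n (h : {vspace 'M[F]_n}) x :
  (h <= sl F n)%VS -> x \in h -> \tr x = 0.
Proof. by move=> /subvP s /s; rewrite memv_sl => /eqP. Qed.

Definition nilpotent_free (F : fieldType) (h : {vspace 'M[F]_3}) :=
  forall z, z \in h -> z *m z *m z = 0 -> z = 0.

(** Evaluate [h] at a nonzero vector [v].  Either some element of [h] kills [v],
    or the evaluation is bijective.  In the latter case some [y] in [h] fixes [v],
    hence also every [x v = x (y v)], so that [y = 1], which is not traceless. *)
Lemma abelian_singular (F : numFieldType) (h : {vspace 'M[F]_3}) :
  (h <= sl F 3)%VS -> \dim h = 3%N -> {in h &, forall x y, x *m y = y *m x} ->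
  exists x, [/\ x \in h, x != 0 & x \notin unitmx].
Proof.
move=> hsl dh hC.
pose v : 'cV[F]_3 := delta_mx 0 0.
have v0 : v != 0.
  by apply/eqP=> /matrixP/(_ 0 0); rewrite !mxE eqxx => /eqP; rewrite oner_eq0.
pose ev : 'Hom('M[F]_3, 'cV[F]_3) := linfun (mulmxr v).
have evE x : ev x = x *m v by rewrite lfunE.
have := limg_ker_dim ev h; rewrite dh.
have [k0 dk|kn0 _] := eqVneq (h :&: lker ev)%VS 0%VS; last first.
  have := memv_pick (h :&: lker ev)%VS; set x := vpick _ => /memv_capP[hx].
  rewrite memv_ker evE => /eqP xv; exists x; split=> //; first by rewrite vpick0.
  apply/negP=> ux; move/eqP: v0; apply.
  by rewrite -[v]mul1mx -(mulVmx ux) -mulmxA xv mulmx0.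
have full : (ev @: h)%VS = fullv.
  apply/eqP; rewrite eqEdim subvf dimvf /=.
  by rewrite k0 dimv0 add0n in dk; rewrite dk.
have [y hy yv] : exists2 y, y \in h & v = y *m v.
  have /memv_imgP[y hy] : v \in (ev @: h)%VS by rewrite full memvf.
  by rewrite evE => E; exists y.
have y1 (w : 'cV[F]_3) : y *m w = w.
  have /memv_imgP[x hx] : w \in (ev @: h)%VS by rewrite full memvf.
  by rewrite evE => ->; rewrite mulmxA (hC y x) // -mulmxA -yv.
have E1 : y = 1%:M.
  apply/matrixP=> i j.
  have := y1 (delta_mx j 0); rewrite -colE => /matrixP/(_ i 0).
  by rewrite !mxE eqxx andbT.
have := memv_slP hsl hy; rewrite E1 mxtrace1 => /eqP.
by rewrite pnatr_eq0.
Qed.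

(** Let [x] be the singular element.  If it is not nilpotent, the polarized
    Cayley-Hamilton identity, multiplied twice by [x], expresses every [y] in [h]
    through [x] and [x ^ 2 - (tr (x ^ 2) / 3)]; this leaves room for only two
    dimensions. *)
Lemma abelian_nilpotent (F : numFieldType) (h : {vspace 'M[F]_3}) :
  (h <= sl F 3)%VS -> \dim h = 3%N -> {in h &, forall x y, x *m y = y *m x} ->
  ~ nilpotent_free h.
Proof.
move=> hsl dh hC nf.
have [x [hx x0 ux]] := abelian_singular hsl dh hC.
have tx := memv_slP hsl hx.
pose A := \tr (x *m x).
have t3 : \tr (x *m x *m x) = 0.
  apply/eqP; apply: contraNT ux => t3.
  have E := CH3 tx.
  pose k := 2 * \tr (x *m x *m x).
  have k0 : k != 0 by rewrite mulf_neq0 // pnatr_eq0.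
  suff /mulmx1_unit[] : x *m (k^-1 *: (6 *: (x *m x) - (3 * A)%:M)) = 1%:M by [].
  rewrite -scalemxAr mulmxBr -scalemxAr mulmxA E -/k -/A mul_mx_scalar addrC addKr.
  by rewrite -scalemx1 scalerA mulVf // scale1r.
have E := CH3 tx; rewrite t3 mulr0 -scalemx1 scale0r addr0 -/A in E.
have A0 : A != 0.
  apply/eqP=> A0; move/eqP: x0; apply; apply: nf => //.
  by apply: nilp_of_traces.
pose q := 6 *: (x *m x) - (2 * A)%:M.
suff sub : (h <= <<[:: x; q]>>)%VS.
  by have := dimvS sub; rewrite dh => /leq_trans/(_ (dim_span _)).
apply/subvP=> y hy.
pose B := \tr (x *m y); pose D := \tr (x *m x *m y).
have H : 6 *: (x *m x *m y) = A *: y + (2 * B) *: x + (2 * D)%:M.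
  rewrite -CH_polarized ?(memv_slP hsl hy) //.
  have -> : x *m y *m x = x *m x *m y by rewrite -mulmxA (hC y) // mulmxA.
  have -> : y *m x *m x = x *m x *m y by rewrite -(hC x y) // -mulmxA (hC y) // mulmxA.
  by mxring.
have H2 : (2 * A) *: (x *m y) = (2 * B) *: (x *m x) + (2 * D) *: x.
  have := congr1 (mulmx x) H; rewrite -scalemxAr !mulmxA scalemxAl E -scalemxAl.
  rewrite !mulmxDr -!scalemxAr mul_mx_scalar => {}H.
  by apply: (addrI (A *: (x *m y))); rewrite addrA -H; mxring.
have H3 : A *: (A *: y) = A *: (B *: x) + D *: q.
  have := congr1 (mulmx x) H2; rewrite -scalemxAr !mulmxDr -!scalemxAr !mulmxA => {}H2.
  apply: (scalerI (_ : 2%:R != 0 :> F)); first by rewrite pnatr_eq0.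
  rewrite /q -scalemx1; rewrite -scalemx1 in H.
  move: (1%:M : 'M[F]_3) H => I H.
  have -> : A *: y = 6 *: (x *m x *m y) - (2 * B) *: x - (2 * D) *: I by rewrite H; mxring.
  have E6 : A *: (6 *: (x *m x *m y)) = B *: (6 *: (x *m x *m x)) + (6 * D) *: (x *m x).
    transitivity (3 *: ((2 * A) *: (x *m x *m y))); first by mxring.
    by rewrite H2; mxring.
  rewrite E in E6.
  rewrite !scalerBr E6; move: (x *m x) => x2; mxring.
move: q H3 => q H3.
have -> : y = (A^-1 * B) *: x + (A^-1 * A^-1 * D) *: q.
  apply: (scalerI A0); apply: (scalerI A0); rewrite H3.
  by rewrite !scalerDr !scalerA; congr (_ *: _ + _ *: _); field; exact: A0.
by rewrite memvD // memvZ // memv_span // !inE eqxx ?orbT.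
Qed.

(** * Subalgebras without nilpotent elements *)

Definition so3_triple (F : fieldType) n (a b c : 'M[F]_n) :=
  [/\ [lie a, b] = c, [lie b, c] = a & [lie c, a] = b].

Section NilpotentFree.
Variables (R : rcfType) (h : {vspace 'M[R]_3}).
Hypotheses (hsl : (h <= sl R 3)%VS) (dh : \dim h = 3%N).
Hypotheses (hsub : lie_subalgebra h) (nf : nilpotent_free h).

Lemma eigen_eq0 x y c : y \in h -> c != 0 -> [lie x, y] = c *: y -> y = 0.
Proof. by move=> hy c0 /(nilp_eigen c0) /(nf hy). Qed.

Lemma exists_noncommuting : exists x y, [/\ x \in h, y \in h & [lie x, y] != 0].
Proof.
apply: contrapT => N; apply: (abelian_nilpotent hsl dh) nf => x y hx hy.
apply: lie_eq0; apply/eqP/negPn/negP => xy0.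
by apply: N; exists x, y.
Qed.

(** A relation would make [span {x, y}] a nonabelian Lie algebra of dimension 2,
    whose derived algebra is spanned by an eigenvector of some [ad], which is
    nilpotent. *)
Lemma indep3_bracket x y : x \in h -> y \in h -> [lie x, y] != 0 ->
  indep3 x y [lie x, y].
Proof.
move=> hx hy z0.
have notin al be : [lie x, y] <> al *: x + be *: y.
  move=> E; have [be0|be0] := eqVneq be 0.
    have al0 : al != 0.
      by apply: contraNneq z0 => al0; rewrite E be0 al0 !scale0r addr0.
    have x0 : x = 0.
      apply: (@eigen_eq0 y x (- al)); rewrite ?oppr_eq0 //.
      by rewrite lieC E be0 scale0r addr0 scaleNr.
    by move/eqP: z0; rewrite x0 lie0l.
  have : y + (al / be) *: x = 0.
    apply: (@eigen_eq0 x _ be) => //; first by rewrite memvD ?memvZ.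
    by rewrite !lieE E; mxfield; exact: be0.
  move/(congr1 (lie_bracket x)); rewrite !lieE scaler0 addr0.
  exact/eqP.
move=> a b c E.
have [c0|c0] := eqVneq c 0; last first.
  case: (notin (- (a / c)) (- (b / c))); apply: (scalerI c0).
  have -> : c *: [lie x, y] = - (a *: x + b *: y).
    by apply/eqP; rewrite -addr_eq0 addrC E.
  mxfield; exact: c0.
move: E; rewrite c0 scale0r addr0 => E.
have /eqP := congr1 (lie_bracket x) E; rewrite !lieE scaler0 add0r.
rewrite scaler_eq0 (negPf z0) orbF => /eqP b0.
move: E; rewrite b0 scale0r addr0 => /eqP; rewrite scaler_eq0 => /orP[/eqP -> //|/eqP x0].
by move/eqP: z0; rewrite x0 lie0l.
Qed.

(** [ga ^ 2 + 4 be] is the discriminant of the map induced by [ad x] on the plane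
    [h / <x>].  A nonzero real eigenvalue of this map lifts to an eigenvector of
    [ad x] in [h], and if both eigenvalues are zero then [x] or [[x, y]] is
    nilpotent. *)
Lemma ad_disc_lt0 x y al be ga : x \in h -> y \in h -> [lie x, y] != 0 ->
  [lie x, [lie x, y]] = al *: x + be *: y + ga *: [lie x, y] ->
  ga ^+ 2 + 4 * be < 0.
Proof.
move=> hx hy z0 E; rewrite ltNge; apply/negP => disc.
have ind := indep3_bracket hx hy z0.
have hz : [lie x, y] \in h by apply: hsub.
have [z xy] : exists z, [lie x, y] = z by exists [lie x, y].
rewrite xy in E ind z0 hz.
have [/andP[/eqP ga0 /eqP be0]|nz] := boolP ((ga == 0) && (be == 0)).
  move: E; rewrite ga0 be0 !scale0r !addr0 => E.
  have [al0|al0] := eqVneq al 0.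
    move/eqP: z0; apply; apply: (nf hz); apply: (@nilp_jacobson _ x y) => //.
    by rewrite E al0 scale0r.
  have x0 : x = 0.
    apply: (@eigen_eq0 z x (- al)); rewrite ?oppr_eq0 //.
    by rewrite lieC E scaleNr.
  by move/eqP: z0; rewrite -xy x0 lie0l.
have [l l0 ll] : exists2 l, l != 0 & l ^+ 2 = ga * l + be.
  have s2 : Num.sqrt (ga ^+ 2 + 4 * be) ^+ 2 = ga ^+ 2 + 4 * be by rewrite sqr_sqrtr.
  have := sqrtr_ge0 (ga ^+ 2 + 4 * be); set s := Num.sqrt _ in s2 * => s0.
  have [ga0|ga0] := leP 0 ga.
    exists ((ga + s) / 2); last by nra.
    apply: contraNneq nz => gs.
    have -> : ga = 0 by lra.
    by rewrite eqxx /=; apply/eqP; nra.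
  exists ((ga - s) / 2); last by nra.
  by apply/eqP => gs; lra.
(* [z + (l - ga) y] spans the eigenline of [l] modulo [x]; the last term
   corrects it to an eigenvector of [ad x] in [h]. *)
pose w := z + (l - ga) *: y + (al / l) *: x.
have w0 : w = 0.
  apply: (@eigen_eq0 x w l) => //; first by apply: memvD; [apply: memvD|]; rewrite ?memvZ.
  rewrite /w !lieE E xy scaler0 addr0.
  transitivity (al *: x + (l ^+ 2 - ga * l) *: y + l *: z); first by rewrite ll; mxring.
  mxfield; exact: l0.
have [|_ _ /eqP] := ind (al / l) (l - ga) 1; last by rewrite oner_eq0.
by rewrite -w0 /w; mxring.
Qed.

End NilpotentFree.

(** If [y] and [z] commute, each of [tr (z w)] and [tr ([x, z] w)] vanishes when
    [w] is a power of [y]; as [be] is nonzero, so does [tr (y w)]. *)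
Lemma commuting_plane_nilp (F : numFieldType) (x y z : 'M[F]_3) be ga :
  be != 0 -> [lie x, y] = z -> [lie x, z] = be *: y + ga *: z ->
  y *m z = z *m y -> y *m y *m y = 0.
Proof.
move=> be0 xy xz yz.
have Hz w : y *m w = w *m y -> \tr (z *m w) = 0.
  by rewrite -xy; apply: tr_lie_mul_comm.
have Hy w : y *m w = w *m y -> z *m w = w *m z -> \tr (y *m w) = 0.
  move=> yw /(tr_lie_mul_comm x); rewrite xz mulmxDl -!scalemxAl linearD !linearZ /=.
  by rewrite (Hz _ yw) mulr0 addr0 => /eqP; rewrite mulf_eq0 (negPf be0) => /eqP.
apply: nilp_of_traces; first by rewrite -[y]mulmx1 Hy // mulmx1 mul1mx.
  exact: Hy.
by rewrite -mulmxA Hy ?mulmxA // -yz -!mulmxA yz.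
Qed.

Section RotationBasis.
Variables (R : rcfType) (h : {vspace 'M[R]_3}).
Hypotheses (hsl : (h <= sl R 3)%VS) (dh : \dim h = 3%N).
Hypotheses (hsub : lie_subalgebra h) (nf : nilpotent_free h).

(** By [ad_disc_lt0] the map [ad x] is invertible on [h / <x>], so [y] can be
    shifted along [x] until the plane spanned by [y] and [z] is stable.  Then
    [[y, z]] is an eigenvector of [ad x] for the eigenvalue [ga], which is
    therefore zero; this makes [[y, z]] a multiple of [x]. *)
Lemma exists_rotation : exists x y z be al,
  [/\ [/\ x \in h, y \in h & z \in h], indep3 x y z, be < 0 /\ al != 0 &
  [/\ [lie x, y] = z, [lie x, z] = be *: y & [lie y, z] = al *: x]].
Proof.
have [x [y [hx hy xy]]] := exists_noncommuting hsl dh nf.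
have ind := indep3_bracket nf hx hy xy.
have hz : [lie x, y] \in h by apply: hsub.
have hE := span3_eq dh hx hy hz ind.
have [al [be [ga E]]] : exists al be ga,
    [lie x, [lie x, y]] = al *: x + be *: y + ga *: [lie x, y].
  by apply/span3P; rewrite -hE; apply: hsub.
have disc := ad_disc_lt0 hsub nf hx hy xy E.
have be0 : be < 0 by nra.
have be_neq0 : be != 0 by rewrite lt_eqF.
pose y' := y + (al / be) *: x.
have xy' : [lie x, y'] = [lie x, y] by rewrite !lieE scaler0 addr0.
have hy' : y' \in h by rewrite memvD ?memvZ.
have ind' : indep3 x y' [lie x, y].
  by rewrite -xy'; apply: (indep3_bracket nf); rewrite ?xy'.
have E' : [lie x, [lie x, y]] = be *: y' + ga *: [lie x, y].
  by rewrite E /y'; mxfield.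
have hE' := span3_eq dh hx hy' hz ind'.
have [z xyz] : exists z, [lie x, y] = z by exists [lie x, y].
rewrite xyz in E' xy' hz ind' hE' xy.
clearbody y'.
have y'0 : y' != 0 by apply: contraNneq xy => y0; rewrite -xy' y0 lie0r.
have yz : [lie y', z] != 0.
  apply: contraNneq y'0 => /lie_eq0 yz; apply/eqP/nf => //.
  exact: commuting_plane_nilp be_neq0 xy' E' yz.
have {}xyz : [lie x, [lie y', z]] = ga *: [lie y', z].
  by rewrite lieJ xy' E' !lieE scaler0 !add0r.
have ga0 : ga = 0.
  apply/eqP; apply: contraNT yz => ga0.
  by rewrite (eigen_eq0 nf _ ga0 xyz) //; apply: hsub.
move: E'; rewrite ga0 scale0r addr0 => E'.
have [a [b [c yzE]]] : exists a b c, [lie y', z] = a *: x + b *: y' + c *: z.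
  by apply/span3P; rewrite -hE'; apply: hsub.
have [|_ bc cc] := ind' 0 (c * be) b.
  move: xyz; rewrite ga0 scale0r yzE !lieE xy' E' => <-.
  by mxring.
have c0 : c = 0 by apply/eqP; move/eqP: bc; rewrite mulf_eq0 (negPf be_neq0) orbF.
move: yzE; rewrite cc c0 !scale0r !addr0 => yzE.
exists x, y', z, be, a; split => //; split=> //.
by apply: contraNneq yz => a0; rewrite yzE a0 scale0r.
Qed.

(** When [al < 0] the algebra is sl(2) and a combination of [x] and [z] is an
    eigenvector of [ad y], hence nilpotent.  When [al > 0] rescaling gives the
    so(3) relations. *)
Lemma exists_so3_triple : exists a b c,
  [/\ a \in h, b \in h, c \in h, a != 0 & so3_triple a b c].
Proof.
have [x [y [z [be [al [[hx hy hz] ind [be0 al0] [xy xz yz]]]]]]] := exists_rotation.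
have al_gt0 : 0 < al.
  rewrite lt_def al0 leNgt; apply/negP=> al_lt0.
  (* [ad y] maps [x + k z] to [k al x - z], a multiple of it when [al k ^ 2 = -1]. *)
  pose k := Num.sqrt (- al)^-1.
  have kk : al * k ^+ 2 = - 1.
    by rewrite sqr_sqrtr ?invr_ge0 ?oppr_ge0 ?ltW // invrN mulrN divff.
  have k0 : k != 0.
    apply/eqP=> k0; move: kk; rewrite k0 expr0n mulr0 => /eqP.
    by rewrite eq_sym oppr_eq0 oner_eq0.
  have w0 : x + k *: z = 0.
    apply: (eigen_eq0 nf (x := y) (c := k * al)); first by rewrite memvD ?memvZ.
      by rewrite mulf_neq0.
    rewrite !lieE yz (lieC y x) xy.
    transitivity ((k * al) *: x + (al * k ^+ 2) *: z); last by mxring.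
    by rewrite kk; mxring.
  have [|/eqP one0 _ _] := ind 1 0 k; last by move: one0; rewrite oner_eq0.
  by rewrite -w0; mxring.
pose w := Num.sqrt (- be).
have w0 : w != 0 by rewrite gt_eqF // sqrtr_gt0 oppr_gt0.
have ww : be = - w ^+ 2 by rewrite sqr_sqrtr ?opprK // oppr_ge0 ltW.
pose k := Num.sqrt al.
have k0 : k != 0 by rewrite gt_eqF // sqrtr_gt0.
have kk : al = k ^+ 2 by rewrite sqr_sqrtr // ltW.
exists (w^-1 *: x), (k^-1 *: y), ((w * k)^-1 *: z); split; rewrite ?memvZ //.
  rewrite scaler_eq0 invr_eq0 (negPf w0) /=; apply/eqP=> x0.
  have [|/eqP one0 _ _] := ind 1 0 0; last by move: one0; rewrite oner_eq0.
  by rewrite x0; mxring.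
split; rewrite !lieE.
- by rewrite xy; mxfield; rewrite ?k0 ?w0.
- by rewrite yz kk; mxfield; rewrite ?k0 ?w0.
- by rewrite lieC xz ww; mxfield; rewrite ?k0 ?w0.
Qed.

End RotationBasis.

(** * Columns and conjugation *)

Section Columns.
Variable F : fieldType.
Implicit Types (u v w : 'cV[F]_3) (A : 'M[F]_3).

Definition cols3 u v w : 'M[F]_3 :=
  \matrix_(i, j) nth 0 [:: u i 0; v i 0; w i 0] j.

Lemma mulmx_cols3 A u v w : A *m cols3 u v w = cols3 (A *m u) (A *m v) (A *m w).
Proof.
apply/matrixP=> i [[|[|[|//]]] lt]; rewrite !mxE /=;
  by apply: eq_bigr => k _; rewrite !mxE.
Qed.

Lemma cols3_mulmx u v w a b c d e f g h i :
  cols3 u v w *m mx3 a b c d e f g h i =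
  cols3 (a *: u + d *: v + g *: w) (b *: u + e *: v + h *: w) (c *: u + f *: v + i *: w).
Proof.
apply/matrixP=> x [[|[|[|//]]] lt]; rewrite !mxE !big_ord_recl big_ord0 !mxE /=; ring.
Qed.

Lemma cols3_inj u v w u' v' w' :
  cols3 u v w = cols3 u' v' w' -> [/\ u = u', v = v' & w = w'].
Proof.
move=> /matrixP E; split; apply/matrixP=> i j; rewrite ord1;
  [have := E i 0 | have := E i 1 | have := E i (inord 2)];
  by rewrite !mxE /= ?inordK.
Qed.

Lemma cols3_mulcV u v w (x : 'cV[F]_3) :
  cols3 u v w *m x = x 0 0 *: u + x 1 0 *: v + x (inord 2) 0 *: w.
Proof.
apply/matrixP=> i j; rewrite ord1 !mxE !big_ord_recl big_ord0 !mxE /= addr0 addrA.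
rewrite ![_ * x _ _]mulrC; congr (x _ _ * _ + x _ _ * _ + x _ _ * _);
  by apply/val_inj; rewrite /= ?inordK.
Qed.

Lemma cols3_unit u v w : indep3 u v w -> cols3 u v w \in unitmx.
Proof.
move=> ind; rewrite -unitmx_tr unitmxE unitfE; apply/negP=> /det0P[x /eqP x0 xg].
apply: x0; apply/trmx_inj; rewrite trmx0.
have := congr1 trmx xg; rewrite trmx_mul trmxK trmx0 cols3_mulcV => /ind[e0 e1 e2].
apply/matrixP=> [[[|[|[|//]]] lt] j]; rewrite ord1 [RHS]mxE;
  [rewrite -[RHS]e0 | rewrite -[RHS]e1 | rewrite -[RHS]e2]; congr (_ _ _); apply/val_inj;
  by rewrite /= ?inordK.
Qed.

Lemma exists_mulmx_neq0 A : A != 0 -> exists u : 'cV_3, A *m u != 0.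
Proof.
move=> A0; have /existsP[j Aj] : [exists j, col j A != 0].
  apply: contraNT A0; rewrite negb_exists => /forallP H.
  apply/eqP/matrixP=> i j; have /negPn/eqP/matrixP/(_ i 0) := H j.
  by rewrite !mxE.
by exists (delta_mx j 0); rewrite -colE.
Qed.

Lemma extend_indep2 u v : (forall a b, a *: u + b *: v = 0 -> a = 0 /\ b = 0) ->
  exists w, indep3 u v w.
Proof.
move=> ind.
have /subvPn[w _ wN] : ~~ (fullv <= <<[:: u; v]>>)%VS.
  apply/negP=> /dimvS; rewrite dimvf /= => /leq_trans/(_ (dim_span _)).
  by [].
exists w => a b c E.
have c0 : c = 0.
  apply/eqP; apply: contraNT wN => c0.
  have -> : w = - (a / c) *: u + - (b / c) *: v.
    apply: (scalerI c0); have -> : c *: w = - (a *: u + b *: v).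
      by apply/eqP; rewrite -addr_eq0 addrC E.
    mxfield; exact: c0.
  by rewrite memvD // memvZ // memv_span // !inE eqxx ?orbT.
by move: E; rewrite c0 scale0r addr0 => /ind[].
Qed.

Lemma extend_indep1 u : u != 0 -> exists v w, indep3 u v w.
Proof.
move=> u0.
have /subvPn[v _ vN] : ~~ (fullv <= <[u]>)%VS.
  by apply/negP=> /dimvS; rewrite dimvf dim_vline /=; case: (u != 0).
exists v; apply: extend_indep2 => a b E.
have b0 : b = 0.
  apply/eqP; apply: contraNT vN => b0; apply/vlineP; exists (- (a / b)).
  apply: (scalerI b0); have -> : b *: v = - (a *: u).
    by apply/eqP; rewrite -addr_eq0 addrC E.
  mxfield; exact: b0.
split=> //; move: E => /eqP; rewrite b0 scale0r addr0 scaler_eq0 (negPf u0) orbF.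
by move/eqP.
Qed.

End Columns.

Section Conjugation.
Variables (F : fieldType) (n : nat).
Implicit Types (g x y : 'M[F]_n).

Lemma Ad_mul g x y : g \in unitmx -> Ad g (x *m y) = Ad g x *m Ad g y.
Proof. by move=> ug; rewrite /Ad !mulmxA mulmxKV. Qed.

Lemma Ad_lie g x y : g \in unitmx -> Ad g [lie x, y] = [lie Ad g x, Ad g y].
Proof. by move=> ug; rewrite /lie_bracket raddfB /= !Ad_mul. Qed.

Lemma AdP g x y : g \in unitmx -> x *m g = g *m y -> Ad g y = x.
Proof. by move=> ug E; rewrite /Ad -E mulmxK. Qed.

Lemma Ad_comp g g' x : g \in unitmx -> g' \in unitmx -> Ad g (Ad g' x) = Ad (g *m g') x.
Proof.
move=> ug ug'; apply/esym/AdP; first by rewrite unitmx_mul ug.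
by rewrite /Ad !mulmxA !mulmxKV.
Qed.

Lemma AdVK g x : g \in unitmx -> Ad (invmx g) (Ad g x) = x.
Proof.
by move=> ug; rewrite Ad_comp ?unitmx_inv // mulVmx // /Ad mul1mx invmx1 mulmx1.
Qed.

Lemma AdKV g x : g \in unitmx -> Ad g (Ad (invmx g) x) = x.
Proof.
by move=> ug; rewrite Ad_comp ?unitmx_inv // mulmxV // /Ad mul1mx invmx1 mulmx1.
Qed.

Lemma tr_Ad g x : g \in unitmx -> \tr (Ad g x) = \tr x.
Proof. by move=> ug; rewrite /Ad mxtrace_mulC mulmxA mulVmx // mul1mx. Qed.

Lemma Ad_mulmx g x : g \in unitmx -> Ad g x *m g = g *m x.
Proof. by move=> ug; rewrite /Ad mulmxKV. Qed.

End Conjugation.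

Section SO3Kernel.
Variable R : realFieldType.
Implicit Types (a b c : 'M[R]_3).

(** In a representation of so(3) the matrices [a] and [- a] are conjugate, so the
    odd invariants of [a] vanish; here the trace of the cube is rewritten through
    brackets. *)
Lemma tr_cube_so3 a b c : so3_triple a b c -> \tr (a *m a *m a) = 0.
Proof.
move=> [ab bc ca].
have tacc : \tr (a *m c *m c) = 0.
  by rewrite -bc -mulmxA; apply: tr_lie_mul_comm; rewrite mulmxA.
have E : [lie b, a *m a *m c] = a *m a *m a - c *m a *m c - a *m c *m c.
  rewrite !lie_mulr bc (lieC b a) ab mulmxDl !mulNmx mulmxN mulNmx.
  by rewrite addrC addrA.
have := tr_lie b (a *m a *m c).
by rewrite E !linearB /= -(mulmxA c) (mxtrace_mulC c) tacc !subr0.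
Qed.

(** The nine equations say that three traceless 2 by 2 matrices form an
    so(3)-triple.  Nonzero ones would, up to a factor, generate the quaternions,
    but real 2 by 2 matrices do not contain two anticommuting square roots of a
    negative number: the determinant has signature (1, 2) on sl(2). *)
Lemma so3_not_in_sl2 (p q r p' q' r' p'' q'' r'' : R) :
  p'' = q * r' - q' * r -> q'' = 2 * (p * q' - p' * q) -> r'' = 2 * (r * p' - p * r') ->
  p = q' * r'' - q'' * r' -> q = 2 * (p' * q'' - p'' * q') -> r = 2 * (r' * p'' - p' * r'') ->
  p' = q'' * r - q * r'' -> q' = 2 * (p'' * q - p * q'') -> r' = 2 * (r'' * p - p'' * r) ->
  [/\ p = 0, q = 0 & r = 0].
Proof.
move=> p2 q2 r2 p0 q0 r0 p1 q1 r1.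
have orth : 2 * p * p' + q * r' + q' * r = 0 by rewrite p0 q0 r0; ring.
have e1 : p = - (4 * (p' ^+ 2 + q' * r')) * p.
  transitivity (- (4 * (p' ^+ 2 + q' * r')) * p + 2 * p' * (2 * p * p' + q * r' + q' * r)).
    by rewrite {1}p0 q2 r2; ring.
  by rewrite orth mulr0 addr0.
have e2 : q = - (4 * (p' ^+ 2 + q' * r')) * q.
  transitivity (- (4 * (p' ^+ 2 + q' * r')) * q + 2 * q' * (2 * p * p' + q * r' + q' * r)).
    by rewrite {1}q0 q2 p2; ring.
  by rewrite orth mulr0 addr0.
have e3 : r = - (4 * (p' ^+ 2 + q' * r')) * r.
  transitivity (- (4 * (p' ^+ 2 + q' * r')) * r + 2 * r' * (2 * p * p' + q * r' + q' * r)).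
    by rewrite {1}r0 p2 r2; ring.
  by rewrite orth mulr0 addr0.
(* [- (p ^ 2 + q r)] is the determinant of the first matrix.  By [e1], [e2] and [e3]
   the first matrix vanishes unless the second one has determinant 1 / 4. *)
have [Q'|Q'] := eqVneq (4 * (p' ^+ 2 + q' * r')) (-1); last first.
  have sol t : t = - (4 * (p' ^+ 2 + q' * r')) * t -> t = 0.
    move=> E; have /eqP : (4 * (p' ^+ 2 + q' * r') + 1) * t = 0.
      by rewrite mulrDl mul1r {2}E; ring.
    by rewrite mulf_eq0 addr_eq0 (negPf Q') => /eqP.
  by split; apply: sol.
have f1 : p' = - (4 * (p ^+ 2 + q * r)) * p'.
  transitivity (- (4 * (p ^+ 2 + q * r)) * p' + 2 * p * (2 * p * p' + q * r' + q' * r)).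
    by rewrite {1}p1 q2 r2; ring.
  by rewrite orth mulr0 addr0.
have f2 : q' = - (4 * (p ^+ 2 + q * r)) * q'.
  transitivity (- (4 * (p ^+ 2 + q * r)) * q' + 2 * q * (2 * p * p' + q * r' + q' * r)).
    by rewrite {1}q1 p2 q2; ring.
  by rewrite orth mulr0 addr0.
have [Q|Q] := eqVneq (4 * (p ^+ 2 + q * r)) (-1).
  have qr : q * r = - (1 / 4) - p ^+ 2 by lra.
  have qr' : q' * r' = - (1 / 4) - p' ^+ 2 by lra.
  have E : (q * r' - q' * r) ^+ 2 = - (1 / 4) - p ^+ 2 - p' ^+ 2.
    transitivity ((2 * p * p' + q * r' + q' * r) * (q * r' + q' * r - 2 * p * p')
                   + 4 * p ^+ 2 * p' ^+ 2 - 4 * (q * r) * (q' * r')); first by ring.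
    by rewrite orth qr qr'; field.
  have := sqr_ge0 (q * r' - q' * r); have := sqr_ge0 p; have := sqr_ge0 p'.
  by rewrite E; lra.
have sol t : t = - (4 * (p ^+ 2 + q * r)) * t -> t = 0.
  move=> E; have /eqP : (4 * (p ^+ 2 + q * r) + 1) * t = 0.
    by rewrite mulrDl mul1r {2}E; ring.
  by rewrite mulf_eq0 addr_eq0 (negPf Q) => /eqP.
by move: Q'; rewrite (sol _ f1) (sol _ f2); lra.
Qed.

(** On the quotient by [v] the triple acts by 2 by 2 matrices, hence trivially by
    [so3_not_in_sl2]. *)
Lemma so3_common_kernel a b c (v : 'cV[R]_3) : so3_triple a b c -> v != 0 ->
  a *m v = 0 -> b *m v = 0 -> c *m v = 0 -> a *m a *m a = 0.
Proof.
move=> [ab bc ca] v0 av bv cv.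
have [p [q ind]] := extend_indep1 v0.
have ug := cols3_unit ind; set g := cols3 v p q in ug.
have col0 x : x *m v = 0 -> exists b0 c0 e f h i : R, Ad (invmx g) x = mx3 0 b0 c0 0 e f 0 h i.
  move=> xv; have [A [B [C [D [E [F [G [H [I EQ]]]]]]]]] := mx3_eta (Ad (invmx g) x).
  have : x *m g = g *m (Ad (invmx g) x) by rewrite -Ad_mulmx // AdKV.
  rewrite EQ mulmx_cols3 cols3_mulmx xv => /cols3_inj[/esym /ind[-> -> ->] _ _].
  by exists B, C, E, F, H, I.
have := col0 a av; have := col0 b bv; have := col0 c cv.
have := congr1 (Ad (invmx g)) ab; have := congr1 (Ad (invmx g)) bc.
have := congr1 (Ad (invmx g)) ca.
rewrite !Ad_lie ?unitmx_inv //.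
have ta : \tr (Ad (invmx g) a) = 0 by rewrite tr_Ad ?unitmx_inv // -bc tr_lie.
have tb : \tr (Ad (invmx g) b) = 0 by rewrite tr_Ad ?unitmx_inv // -ca tr_lie.
have tc : \tr (Ad (invmx g) c) = 0 by rewrite tr_Ad ?unitmx_inv // -ab tr_lie.
suff H : [lie Ad (invmx g) c, Ad (invmx g) a] = Ad (invmx g) b ->
  [lie Ad (invmx g) b, Ad (invmx g) c] = Ad (invmx g) a -> 
  [lie Ad (invmx g) a, Ad (invmx g) b] = Ad (invmx g) c ->
  (exists b0 c0 e f h i : R, Ad (invmx g) c = mx3 0 b0 c0 0 e f 0 h i) ->
  (exists b0 c0 e f h i : R, Ad (invmx g) b = mx3 0 b0 c0 0 e f 0 h i) ->
  (exists b0 c0 e f h i : R, Ad (invmx g) a = mx3 0 b0 c0 0 e f 0 h i) ->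
  Ad (invmx g) a *m Ad (invmx g) a *m Ad (invmx g) a = 0.
  move=> h1 h2 h3 h4 h5 h6; have := H h1 h2 h3 h4 h5 h6.
  rewrite -!Ad_mul ?unitmx_inv // => /(congr1 (Ad g)).
  by rewrite AdKV // linear0.
clear ab bc ca av bv cv.
move: (Ad _ a) (Ad _ b) (Ad _ c) ta tb tc => {}a {}b {}c ta tb tc ca bc ab.
move=> [k'' [l'' [p'' [q'' [r'' [s'' E'']]]]]] [k' [l' [p' [q' [r' [s' E']]]]]].
move=> [k [l [p0 [q0 [r [s E]]]]]]; rewrite E.
move: ta tb tc ab bc ca; rewrite {}E {}E' {}E'' /lie_bracket !mx3E.
move=> ta tb tc /mx3_inj[_ [[_ [a1 a2]] [_ [a3 _]]]].
move=> /mx3_inj[_ [[_ [b1 b2]] [_ [b3 _]]]] /mx3_inj[_ [[_ [c1 c2]] [_ [c3 _]]]].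
have Es : s = - p0 by rewrite -[RHS]add0r -ta; ring.
have Es' : s' = - p' by rewrite -[RHS]add0r -tb; ring.
have Es'' : s'' = - p'' by rewrite -[RHS]add0r -tc; ring.
rewrite {}Es {}Es' {}Es'' in a1 a2 a3 b1 b2 b3 c1 c2 c3 *.
have [||||||||| P Q Z] := @so3_not_in_sl2 p0 q0 r p' q' r' p'' q'' r''.
- by rewrite -a1; ring.
- by rewrite -a2; ring.
- by rewrite -a3; ring.
- by rewrite -b1; ring.
- by rewrite -b2; ring.
- by rewrite -b3; ring.
- by rewrite -c1; ring.
- by rewrite -c2; ring.
- by rewrite -c3; ring.
by rewrite P Q Z; congr mx3; ring.
Qed.

End SO3Kernel.

(** * Normal form of an so(3)-triple *)

Lemma singular_kernel (F : fieldType) n (a : 'M[F]_n) : a \notin unitmx ->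
  exists2 v : 'cV_n, v != 0 & a *m v = 0.
Proof.
rewrite -unitmx_tr unitmxE unitfE negbK => /det0P[u u0 E].
by exists u^T; rewrite ?trmx_eq0 //; apply: trmx_inj; rewrite trmx_mul trmxK E trmx0.
Qed.

Section SO3NormalForm.
Variable R : realFieldType.
Implicit Types (a b c : 'M[R]_3).

Lemma so3_singular a b c : so3_triple a b c -> a *m a *m a != 0 -> a \notin unitmx.
Proof.
move=> abc a3; apply: contraNN a3 => ua.
have ta : \tr a = 0 by case: abc => _ <- _; apply: tr_lie.
have := CH3 ta; rewrite (tr_cube_so3 abc) mulr0 -scalemx1 scale0r addr0.
move/(congr1 (mulmx (invmx a))); rewrite -!scalemxAr mulVmx // -mulmxA mulKmx // => E.
have t0 : \tr (a *m a) = 0.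
  by have := congr1 (@mxtrace _ _) E; rewrite !linearZ /= mxtrace1; lra.
move: E; rewrite t0 mulr0 scale0r => /eqP; rewrite scaler_eq0 pnatr_eq0 /= => /eqP ->.
by rewrite mulmx0.
Qed.

(** If [v] spans the kernel of [a], then [v, b v, c v] is a basis in which the
    relations determine the three matrices. *)
Lemma so3_normal_form a b c : so3_triple a b c -> a *m a *m a != 0 ->
  exists2 g, g \in unitmx &
  [/\ Ad g (mx3 0 0 0 0 0 (-1) 0 1 0) = a, Ad g (mx3 0 (-1) 0 1 0 0 0 0 0) = b &
      Ad g (mx3 0 0 (-1) 0 0 0 1 0 0) = c].
Proof.
move=> abc a3; have [v v0 av] := singular_kernel (so3_singular abc a3).
have [ab bc ca] := abc.
have p0 : b *m v != 0.
  apply: contraNneq a3 => bv; apply/eqP.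
  by apply: (so3_common_kernel abc v0); rewrite // -ab mulmxBl -!mulmxA av bv !mulmx0 subrr.
have apE : a *m (b *m v) = c *m v by rewrite -ab mulmxBl -!mulmxA av mulmx0 subr0.
have aqE : a *m (c *m v) = - (b *m v) by rewrite -ca mulmxBl -!mulmxA av mulmx0 sub0r opprK.
have ind : indep3 v (b *m v) (c *m v).
  move: (b *m v) (c *m v) p0 apE aqE => p q p0 ap aq x y z E.
  have E1 := congr1 (mulmx a) E.
  rewrite !mulmxDr -!scalemxAr av ap aq mulmx0 scaler0 add0r in E1.
  have E2 := congr1 (mulmx a) E1; rewrite !mulmxDr -!scalemxAr mulmxN ap aq mulmx0 in E2.
  have /eqP : (y ^+ 2 + z ^+ 2) *: p = 0.
    transitivity (- z *: (y *: q + z *: - p) - y *: (y *: - p + z *: - q)); first by mxring.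
    by rewrite E1 E2 !scaler0 subr0.
  rewrite scaler_eq0 (negPf p0) orbF paddr_eq0 ?sqr_ge0 // !sqrf_eq0 => /andP[/eqP y0 /eqP z0].
  split=> //; move: E => /eqP; rewrite y0 z0 !scale0r !addr0 scaler_eq0 (negPf v0) orbF.
  by move/eqP.
have ug := cols3_unit ind; set g := cols3 _ _ _ in ug; exists g => //.
have ug' : invmx g \in unitmx by rewrite unitmx_inv.
have aE : Ad g (mx3 0 0 0 0 0 (-1) 0 1 0) = a.
  apply: AdP => //; rewrite mulmx_cols3 cols3_mulmx av apE aqE.
  by congr cols3; mxring.
have aE' : Ad (invmx g) a = mx3 0 0 0 0 0 (-1) 0 1 0 by rewrite -aE AdVK.
suff [bE cE] : Ad (invmx g) b = mx3 0 (-1) 0 1 0 0 0 0 0 /\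
               Ad (invmx g) c = mx3 0 0 (-1) 0 0 0 1 0 0.
  by split; rewrite // -?bE -?cE AdKV.
have := congr1 (Ad (invmx g)) ab; have := congr1 (Ad (invmx g)) bc.
have := congr1 (Ad (invmx g)) ca; rewrite !Ad_lie // aE'.
have := mx3_eta (Ad (invmx g) c); have := mx3_eta (Ad (invmx g) b).
move=> [b1 [b2 [b3 [b4 [b5 [b6 [b7 [b8 [b9 bE]]]]]]]]].
move=> [c1 [c2 [c3 [c4 [c5 [c6 [c7 [c8 [c9 cE]]]]]]]]].
have : b *m g = g *m (Ad (invmx g) b) by rewrite -Ad_mulmx // AdKV.
rewrite bE mulmx_cols3 cols3_mulmx => /cols3_inj[+ _ _].
move/eqP; rewrite -subr_eq0 => /eqP E.
have [|z1 z4 z7] := ind b1 (b4 - 1) b7; first by rewrite -[RHS]oppr0 -E; mxring.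
have : c *m g = g *m (Ad (invmx g) c) by rewrite -Ad_mulmx // AdKV.
rewrite cE mulmx_cols3 cols3_mulmx => /cols3_inj[+ _ _].
move/eqP; rewrite -subr_eq0 => /eqP {}E.
have [|y1 y4 y7] := ind c1 c4 (c7 - 1); first by rewrite -[RHS]oppr0 -E; mxring.
rewrite /lie_bracket !mx3E => /mx3_inj [[e1 [e2 e3]] [[e4 [e5 e6]] [e7 [e8 e9]]]].
move=> H /mx3_inj [[f1 [f2 f3]] [[f4 [f5 f6]] [f7 [f8 f9]]]].
have {}z4 : b4 = 1 by lra. have {}y7 : c7 = 1 by lra.
have b50 : b5 = 0 by lra. have b60 : b6 = 0 by lra.
have b80 : b8 = 0 by lra. have b90 : b9 = 0 by lra.
have c50 : c5 = 0 by lra. have c60 : c6 = 0 by lra.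
have c80 : c8 = 0 by lra. have c90 : c9 = 0 by lra.
move: H; rewrite z1 z4 z7 y1 y4 y7 b50 b60 b80 b90 c50 c60 c80 c90.
move=> /mx3_inj [[g1 [g2 g3]] [[g4 [g5 g6]] [g7 [g8 g9]]]].
clear -g1 g2 g3 g4 g5 g6 g7 g8 g9.
by split; congr mx3; lra.
Qed.

End SO3NormalForm.

(** * Normal forms of nilpotent matrices and of sl(2)-triples *)

Definition sl2_triple (F : fieldType) n (z t u : 'M[F]_n) :=
  [/\ [lie z, u] = t, [lie t, z] = 2 *: z & [lie t, u] = - 2 *: u].

Lemma sl2_triple_Ad (F : fieldType) n (g z t u : 'M[F]_n) : g \in unitmx ->
  sl2_triple z t u -> sl2_triple (Ad g z) (Ad g t) (Ad g u).
Proof. by move=> ug [zu tz tu]; split; rewrite -Ad_lie // ?zu ?tz ?tu ?linearZ. Qed.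

Section NilpotentNormalForm.
Variable R : realFieldType.
Implicit Types (g x y z t u : 'M[R]_3).

(** The triple [(regZ, regT, regU)] is the irreducible representation of sl(2) on
    a 3-dimensional space, in a basis of weight vectors. *)
Definition regZ : 'M[R]_3 := mx3 0 1 0 0 0 1 0 0 0.
Definition regT : 'M[R]_3 := mx3 2 0 0 0 0 0 0 0 (- 2).
Definition regU : 'M[R]_3 := mx3 0 0 0 2 0 0 0 2 0.
(** The triple [(minZ, minT, minU)] is the sum of the standard and the trivial
    representation of sl(2). *)
Definition minZ : 'M[R]_3 := mx3 0 1 0 0 0 0 0 0 0.
Definition minT : 'M[R]_3 := mx3 1 0 0 0 (-1) 0 0 0 0.
Definition minU : 'M[R]_3 := mx3 0 0 0 1 0 0 0 0 0.

Lemma reg_triple : sl2_triple regZ regT regU.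
Proof. by split; rewrite /lie_bracket /regZ /regT /regU !mx3E; congr mx3; ring. Qed.

Lemma min_triple : sl2_triple minZ minT minU.
Proof. by split; rewrite /lie_bracket /minZ /minT /minU !mx3E; congr mx3; ring. Qed.

Lemma nilp_normal_reg z : z *m z *m z = 0 -> z *m z != 0 ->
  exists2 g, g \in unitmx & Ad g regZ = z.
Proof.
move=> z3 /exists_mulmx_neq0[w zzw].
have z3w : z *m (z *m (z *m w)) = 0 by rewrite !mulmxA z3 mul0mx.
rewrite -mulmxA in zzw.
have ind : indep3 (z *m (z *m w)) (z *m w) w.
  move=> a b c E.
  have E1 := congr1 (mulmx z) E.
  rewrite !mulmxDr -!scalemxAr z3w mulmx0 scaler0 add0r in E1.
  have /eqP := congr1 (mulmx z) E1.
  rewrite !mulmxDr -!scalemxAr z3w mulmx0 scaler0 add0r scaler_eq0 (negPf zzw) orbF => /eqP c0.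
  move: E1 => /eqP; rewrite c0 scale0r addr0 scaler_eq0 (negPf zzw) orbF => /eqP b0.
  split=> //; apply/eqP; move: E => /eqP.
  by rewrite c0 b0 !scale0r !addr0 scaler_eq0 (negPf zzw) orbF.
exists (cols3 (z *m (z *m w)) (z *m w) w); first exact: cols3_unit.
apply: AdP; first exact: cols3_unit.
by rewrite mulmx_cols3 cols3_mulmx z3w; congr cols3; mxring.
Qed.

Lemma nilp_normal_min z : z *m z = 0 -> z != 0 ->
  exists2 g, g \in unitmx & Ad g minZ = z.
Proof.
move=> z2 /exists_mulmx_neq0[w zw].
have z2w : z *m (z *m w) = 0 by rewrite mulmxA z2 mul0mx.
have ind2 a b : a *: (z *m w) + b *: w = 0 -> a = 0 /\ b = 0.
  move=> E; have /eqP := congr1 (mulmx z) E.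
  rewrite mulmxDr -!scalemxAr z2w mulmx0 scaler0 add0r scaler_eq0 (negPf zw) orbF => /eqP b0.
  split=> //; apply/eqP; move: E => /eqP.
  by rewrite b0 scale0r addr0 scaler_eq0 (negPf zw) orbF.
have [k0 ind] := extend_indep2 ind2.
have ug := cols3_unit ind.
pose c := invmx (cols3 (z *m w) w k0) *m (z *m k0).
have zk0 : z *m k0 = c 0 0 *: (z *m w) + c 1 0 *: w + c (inord 2) 0 *: k0.
  by rewrite -cols3_mulcV /c mulmxA mulmxV // mul1mx.
move: (c 0 0) (c 1 0) (c (inord 2) 0) zk0 => al be ga zk0.
have E := congr1 (mulmx z) zk0.
rewrite mulmxA z2 mul0mx !mulmxDr -!scalemxAr z2w scaler0 add0r in E.
have [|be0 _ /eqP ga0] := ind (be + ga * al) (ga * be) (ga * ga).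
  by rewrite [RHS]E zk0; mxring.
have {}ga0 : ga = 0 by apply/eqP; rewrite mulf_eq0 orbb in ga0.
have {}be0 : be = 0 by rewrite ga0 mul0r addr0 in be0.
rewrite be0 ga0 !scale0r !addr0 in zk0.
have ind' : indep3 (z *m w) w (k0 - al *: w).
  move=> a b d E'; have [|-> b0 ->] := ind a (b - d * al) d; first by rewrite -[RHS]E'; mxring.
  have := ind a (b - d * al) d.
  have [|_ _ d0] := ind a (b - d * al) d; first by rewrite -[RHS]E'; mxring.
  by rewrite d0 mul0r subr0 in b0.
exists (cols3 (z *m w) w (k0 - al *: w)); first exact: cols3_unit.
apply: AdP; first exact: cols3_unit.
rewrite mulmx_cols3 cols3_mulmx z2w mulmxBr -scalemxAr zk0 subrr.
by congr cols3; mxring.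
Qed.

(** For 3 by 3 matrices it is enough to exhibit the triple of each of the two
    normal forms. *)
Lemma jacobson_morozov z : z *m z *m z = 0 -> z != 0 ->
  exists t u, [/\ \tr t = 0, \tr u = 0 & sl2_triple z t u].
Proof.
move=> z3 z0; have [z2|z2] := eqVneq (z *m z) 0.
  have [g ug <-] := nilp_normal_min z2 z0.
  exists (Ad g minT), (Ad g minU); rewrite !tr_Ad // !mx3E; split; [ring|ring|].
  exact: sl2_triple_Ad min_triple.
have [g ug <-] := nilp_normal_reg z3 z2.
exists (Ad g regT), (Ad g regU); rewrite !tr_Ad // !mx3E; split; [ring|ring|].
exact: sl2_triple_Ad reg_triple.
Qed.

(** Once [z] is in normal form, [[t, z] = 2 z] determines [t] up to an element of
    the centralizer of [z]; a unipotent matrix commuting with [z] removes the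
    difference, and the remaining relations determine [u]. *)
Lemma sl2_triple_normal_reg z t u : sl2_triple z t u -> z *m z != 0 ->
  exists2 g, g \in unitmx & [/\ Ad g regZ = z, Ad g regT = t & Ad g regU = u].
Proof.
move=> ztu z2; have two0 : 2 != 0 :> R by rewrite pnatr_eq0.
have z3 : z *m z *m z = 0 by case: ztu => _ tz _; apply: nilp_eigen two0 tz.
have [g ug gz] := nilp_normal_reg z3 z2; rewrite -{}gz {z z2 z3} in ztu *.
have ug' : invmx g \in unitmx by rewrite unitmx_inv.
suff [n un [nz nt nu]] : exists2 n, n \in unitmx &
    [/\ Ad n regZ = regZ, Ad n regT = Ad (invmx g) t & Ad n regU = Ad (invmx g) u].
  exists (g *m n); first by rewrite unitmx_mul ug.
  by rewrite -!Ad_comp // nz nt nu !AdKV.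
have := sl2_triple_Ad ug' ztu; rewrite AdVK //.
move: (Ad (invmx g) t) (Ad (invmx g) u) => {ztu} {}t {}u [zu tz tu].
have [al [be tE]] : exists al be, t = mx3 2 al be 0 0 al 0 0 (- 2).
  have := tr_lie regZ u; rewrite zu; move: tz.
  have [a [b [c [d [e [f [g' [h [i ->]]]]]]]]] := mx3_eta t.
  rewrite /lie_bracket /regZ !mx3E.
  move=> /mx3_inj [[e1 [e2 e3]] [[e4 [e5 e6]] [e7 [e8 e9]]]] t0.
  by exists b, c; congr mx3; lra.
(* The columns of [n] are eigenvectors of [t] for 2, 0 and -2. *)
pose x := - al / 2; pose y := (- (al * x + be)) / 4.
pose n := mx3 1 x y 0 1 x 0 0 1.
have un : n \in unitmx.
  have : n *m mx3 1 (- x) (x ^+ 2 - y) 0 1 (- x) 0 0 1 = 1%:M.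
    by rewrite scalar_mx3 /n !mx3E; congr mx3; ring.
  by case/mulmx1_unit.
have un' : invmx n \in unitmx by rewrite unitmx_inv.
have nz : Ad n regZ = regZ by apply: AdP => //; rewrite /regZ /n !mx3E; congr mx3; ring.
have nt : Ad n regT = t.
  by apply: AdP => //; rewrite /regT /n tE !mx3E; congr mx3; rewrite /y /x; field.
exists n => //; split=> //; rewrite -(AdKV u un); congr (Ad n _).
have := congr1 (Ad (invmx n)) zu; have := congr1 (Ad (invmx n)) tu.
rewrite !Ad_lie // linearZ /= -nz -nt !AdVK // => {tz zu tu nz nt tE}.
have [a [b [c [d [e [f [g' [h [i ->]]]]]]]]] := mx3_eta (Ad (invmx n) u).
rewrite /lie_bracket /regZ /regT /regU !mx3E.
move=> /mx3_inj [[e1 [e2 e3]] [[e4 [e5 e6]] [e7 [e8 e9]]]].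
move=> /mx3_inj [[f1 [f2 f3]] [[f4 [f5 f6]] [f7 [f8 f9]]]].
by congr mx3; lra.
Qed.

(** Same strategy as for [sl2_triple_normal_reg], with another centralizer. *)
Lemma sl2_triple_normal_min z t u : sl2_triple z t u -> z *m z = 0 -> z != 0 ->
  exists2 g, g \in unitmx & [/\ Ad g minZ = z, Ad g minT = t & Ad g minU = u].
Proof.
move=> ztu z2 z0.
have [g ug gz] := nilp_normal_min z2 z0; rewrite -{}gz {z z2 z0} in ztu *.
have ug' : invmx g \in unitmx by rewrite unitmx_inv.
suff [n un [nz nt nu]] : exists2 n, n \in unitmx &
    [/\ Ad n minZ = minZ, Ad n minT = Ad (invmx g) t & Ad n minU = Ad (invmx g) u].
  exists (g *m n); first by rewrite unitmx_mul ug.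
  by rewrite -!Ad_comp // nz nt nu !AdKV.
have := sl2_triple_Ad ug' ztu; rewrite AdVK //.
move: (Ad (invmx g) t) (Ad (invmx g) u) => {ztu} {}t {}u [zu tz tu].
have [b [c [d tE]]] : exists b c d, t = mx3 1 b c 0 (-1) 0 0 d 0.
  have t0 := tr_lie minZ u; rewrite zu in t0; move: tz t0 (zu).
  have [a [b [c [d [e [f [g' [h [i ->]]]]]]]]] := mx3_eta t.
  have [a' [b' [c' [d' [e' [f' [g'' [h' [i' ->]]]]]]]]] := mx3_eta u.
  rewrite /lie_bracket /minZ !mx3E.
  move=> /mx3_inj [[e1 [e2 e3]] [[e4 [e5 e6]] [e7 [e8 e9]]]] t0.
  move=> /mx3_inj [[f1 [f2 f3]] [[f4 [f5 f6]] [f7 [f8 f9]]]].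
  by exists b, c, h; congr mx3; lra.
(* The columns of [n] are eigenvectors of [t] for 1, -1 and 0. *)
pose x := (d * c - b) / 2.
pose n := mx3 1 x (- c) 0 1 0 0 (- d) 1.
have un : n \in unitmx.
  have : n *m mx3 1 (c * d - x) c 0 1 0 0 d 1 = 1%:M.
    by rewrite scalar_mx3 /n !mx3E; congr mx3; ring.
  by case/mulmx1_unit.
have un' : invmx n \in unitmx by rewrite unitmx_inv.
have nz : Ad n minZ = minZ by apply: AdP => //; rewrite /minZ /n !mx3E; congr mx3; ring.
have nt : Ad n minT = t.
  by apply: AdP => //; rewrite /minT /n tE !mx3E; congr mx3; rewrite /x; field.
exists n => //; split=> //; rewrite -(AdKV u un); congr (Ad n _).
have := congr1 (Ad (invmx n)) zu; have := congr1 (Ad (invmx n)) tu.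
rewrite !Ad_lie // linearZ /= -nz -nt !AdVK // => {tz zu tu nz nt tE}.
have [a [b' [c' [d' [e [f [g' [h [i ->]]]]]]]]] := mx3_eta (Ad (invmx n) u).
rewrite /lie_bracket /minZ /minT /minU !mx3E.
move=> /mx3_inj [[e1 [e2 e3]] [[e4 [e5 e6]] [e7 [e8 e9]]]].
move=> /mx3_inj [[f1 [f2 f3]] [[f4 [f5 f6]] [f7 [f8 f9]]]].
by congr mx3; lra.
Qed.

End NilpotentNormalForm.

(** * Invariant complements and their transport *)

Section ReductivePair.
Variables (F : fieldType) (n : nat) (s h m : {vspace 'M[F]_n}).
Hypothesis red : reductive_pair s h m.

Lemma reductive_sub : (h <= s)%VS /\ (m <= s)%VS.
Proof. by case: red => _ <- _ _; split; [apply: addvSr | apply: addvSl]. Qed.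

Lemma reductive_split y : y \in s -> exists2 x, x \in h & y - x \in m.
Proof.
case: red => _ <- _ _ /memv_addP[u um [x xh ->]].
by exists x => //; rewrite addrK.
Qed.

Lemma reductive_eq0 x : x \in h -> x \in m -> x = 0.
Proof.
case: red => _ _ mh _ xh xm; apply/eqP; rewrite -memv0 -mh memv_cap xm.
exact: xh.
Qed.

(** Split [y] as [x + (y - x)] with [x] in [h] and [y - x] in [m].  Both summands
    are stable under [D], so comparing the components in [h] of the two
    expressions of [D y] gives [k x = k' x]. *)
Lemma casimir_mem (a1 b1 a2 b2 a3 b3 : 'M[F]_n) (k k' : F) y :
  let D x := [lie a1, [lie b1, x]] + [lie a2, [lie b2, x]] + [lie a3, [lie b3, x]] in
  {subset [:: a1; b1; a2; b2; a3; b3] <= h} ->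
  {in h, forall x, D x = k *: x} -> D y = k' *: y -> k != k' -> y \in s -> y \in m.
Proof.
move=> D sub Dh Dy kk' /reductive_split[x xh yx].
suff /eqP : (k - k') *: x = 0.
  rewrite scaler_eq0 subr_eq0 (negPf kk') /= => /eqP x0.
  by move: yx; rewrite x0 subr0.
apply: reductive_eq0; first by rewrite memvZ.
have Dm : D (y - x) \in m.
  case: red => _ _ _ inv.
  by rewrite /D; apply: memvD; [apply: memvD|]; do ?[apply: (inv)];
    rewrite // sub // !inE eqxx ?orbT.
have -> : (k - k') *: x = k' *: (y - x) - D (y - x).
  have -> : D (y - x) = D y - D x.
    rewrite /D !(lieDr _ y) !lieNr (lieDr a1) (lieDr a2) (lieDr a3) !lieNr.
    by rewrite !opprD [RHS]addrACA; congr (_ + _); rewrite addrACA.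
  by rewrite Dy Dh //; mxring.
by rewrite memvB // memvZ.
Qed.

End ReductivePair.

Section Morozov.
Variables (R : realFieldType) (h m : {vspace 'M[R]_3}).
Hypothesis red : reductive_pair (sl R 3) h m.

(** These are the components in [h] of the elements [t0] and [f0] of an
    sl(2)-triple of [sl_3]: brackets with [z] respect the decomposition. *)
Lemma reductive_projected_pair z : z \in h -> z != 0 -> z *m z *m z = 0 ->
  exists t u, [/\ t \in h, u \in h, [lie z, u] = t & [lie t, z] = 2 *: z].
Proof.
move=> hz z0 /jacobson_morozov/(_ z0)[t0 [f0 [tt tf [zf tz _]]]].
have [|t ht tm] := @reductive_split _ _ _ _ _ red t0; first by rewrite memv_sl tt.
have [|f hf fm] := @reductive_split _ _ _ _ _ red f0; first by rewrite memv_sl tf.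
case: (red) => sub _ _ inv; exists t, f; split=> //.
  apply/eqP; rewrite -subr_eq0; apply/eqP; apply: (reductive_eq0 red).
    by rewrite memvB // sub.
  have := inv _ _ hz fm; rewrite !lieE zf => E.
  have -> : [lie z, f] - t = (t0 - t) - (t0 - [lie z, f]).
    by rewrite opprB [RHS]addrC addrA subrK.
  exact: memvB.
apply/eqP; rewrite -subr_eq0; apply/eqP; apply: (reductive_eq0 red).
  by rewrite memvB ?memvZ // sub.
have := inv _ _ hz tm; rewrite !lieE !(lieC z) tz.
by rewrite opprK addrC.
Qed.

(** The elements [z, t, u] given by [reductive_projected_pair] form a basis of [h].
    The Jacobi identity leaves [[t, u] = a z - 2 u] as the only possibility, and a
    multiple of [z] added to [u] makes [a] vanish. *)
Lemma reductive_triple z : \dim h = 3%N -> z \in h -> z != 0 -> z *m z *m z = 0 ->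
  exists t u, [/\ t \in h, u \in h & sl2_triple z t u].
Proof.
move=> dh hz z0 z3; have [t [u [ht hu zu tz]]] := reductive_projected_pair hz z0 z3.
have ind : indep3 z t u.
  move=> a b c E; have E1 := congr1 (lie_bracket z) E.
  rewrite !lieE (lieC z t) tz zu scaler0 add0r in E1.
  have /eqP := congr1 (lie_bracket z) E1.
  rewrite !lieE (lieC z t) tz !(scaler0, oppr0, add0r, scalerN, scalerA, oppr_eq0).
  rewrite scaler_eq0 (negPf z0) orbF mulf_eq0 pnatr_eq0 orbF => /eqP c0.
  move: E1 => /eqP; rewrite c0 scale0r addr0 scalerN scalerA oppr_eq0.
  rewrite scaler_eq0 (negPf z0) orbF mulf_eq0 pnatr_eq0 orbF => /eqP b0.
  split=> //; move: E => /eqP; rewrite b0 c0 !scale0r !addr0.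
  by rewrite scaler_eq0 (negPf z0) orbF => /eqP.
have sub : lie_subalgebra h by case: red.
have [a [b [c tu]]] : exists a b c, [lie t, u] = a *: z + b *: t + c *: u.
  by apply/span3P; rewrite -(span3_eq dh hz ht hu ind); apply: sub.
have [|b0 c0 _] := ind (- 2 * b) (c + 2) 0.
  have := lieJ t z u; rewrite zu tz tu !lieE (lieC z t) tz zu => E.
  by rewrite [RHS]E; mxring.
have {}b0 : b = 0 by lra.
have {}c0 : c = - 2 by lra.
exists t, (u - (a / 4) *: z); split=> //; first by rewrite memvB ?memvZ.
split=> //; first by rewrite !lieE zu scaler0 subr0.
by rewrite !lieE tz tu b0 c0; mxfield.
Qed.

End Morozov.

Local Notation AdV g V := (linfun (Ad g) @: V)%VS.

Section Transport.
Variables (F : fieldType) (n : nat).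
Implicit Types (g x y : 'M[F]_n) (V W h m k : {vspace 'M[F]_n}).

Lemma memv_Ad g V x : g \in unitmx -> (x \in AdV g V) = (Ad (invmx g) x \in V).
Proof.
move=> ug; apply/memv_imgP/idP => [[y yV ->]|xV]; first by rewrite lfunE AdVK.
by exists (Ad (invmx g) x); rewrite ?lfunE /= ?AdKV.
Qed.

Lemma AdV_comp g g' V : g \in unitmx -> g' \in unitmx ->
  AdV g (AdV g' V) = AdV (g *m g') V.
Proof.
move=> ug ug'; rewrite -limg_comp; apply: eq_in_limg => x _.
by rewrite comp_lfunE !lfunE /= Ad_comp.
Qed.

Lemma AdVVK g V : g \in unitmx -> AdV (invmx g) (AdV g V) = V.
Proof.
move=> ug; apply/vspaceP=> x; rewrite !memv_Ad ?unitmx_inv // invmxK AdVK //.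
Qed.

Lemma AdVKV g V : g \in unitmx -> AdV g (AdV (invmx g) V) = V.
Proof. by move=> ug; rewrite -{1}(invmxK g) AdVVK ?unitmx_inv. Qed.

Lemma dim_AdV g V : g \in unitmx -> \dim (AdV g V) = \dim V.
Proof.
move=> ug; apply: limg_dim_eq; apply/eqP; rewrite -subv0; apply/subvP=> x.
rewrite memv_cap memv_ker lfunE /= => /andP[_ /eqP E].
by rewrite memv0 -(AdVK x ug) E linear0.
Qed.

Lemma AdV_sl g : g \in unitmx -> AdV g (sl F n) = sl F n.
Proof.
by move=> ug; apply/vspaceP=> x; rewrite memv_Ad // !memv_sl tr_Ad ?unitmx_inv.
Qed.

Lemma AdV_subalgebra g V : g \in unitmx -> lie_subalgebra V -> lie_subalgebra (AdV g V).
Proof.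
by move=> ug sV x y; rewrite !memv_Ad // => xV yV; rewrite Ad_lie ?unitmx_inv // sV.
Qed.

Lemma AdV_reductive g h m : g \in unitmx ->
  reductive_pair (sl F n) h m -> reductive_pair (sl F n) (AdV g h) (AdV g m).
Proof.
move=> ug [sub dec dis inv]; split.
- exact: AdV_subalgebra.
- by rewrite -limgD dec AdV_sl.
- apply/eqP; rewrite -subv0; apply/subvP=> x; rewrite memv_cap !memv_Ad // => xmh.
  have : Ad (invmx g) x \in (m :&: h)%VS by rewrite memv_cap.
  by rewrite dis !memv0 => /eqP E; rewrite -(AdKV x ug) E linear0.
- by move=> x y; rewrite !memv_Ad // Ad_lie ?unitmx_inv //; apply: inv.
Qed.

Lemma AdV_generates g m : g \in unitmx ->
  lie_generates m (sl F n) -> lie_generates (AdV g m) (sl F n).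
Proof.
move=> ug [msl gen]; split; first by rewrite -(AdV_sl ug) limgS.
have ug' : invmx g \in unitmx by rewrite unitmx_inv.
move=> k sk mk; have := gen (AdV (invmx g) k) (AdV_subalgebra ug' sk).
rewrite -{1}(AdVVK m ug) limgS // => /(_ isT)/(limgS (linfun (Ad g))).
by rewrite AdV_sl // AdVKV.
Qed.

End Transport.

(** Scale [g] by a cube root of the inverse of its determinant. *)
Lemma SL_of_GL (R : rcfType) (g : 'M[R]_3) : g \in unitmx ->
  exists2 g', \det g' = 1 & Ad g' =1 Ad g.
Proof.
move=> ug; pose c := (\det g)^-1.
have dg0 : \det g != 0 by rewrite -unitfE -unitmxE.
have [r r3] : exists r : R, r ^+ 3 = c.
  pose p : {poly R} := 'X^3 - c%:P; pose M := 1 + `|c|.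
  have pE x : p.[x] = x ^+ 3 - c by rewrite !hornerE.
  have M1 : 1 <= M by rewrite lerDl normr_ge0.
  have cM : `|c| <= M by rewrite lerDr.
  have MM : M <= M ^+ 3 by rewrite -{1}[M]expr1 ler_weXn2l.
  clearbody M.
  (* [p] changes sign between [- M] and [M]. *)
  have [||r _ /rootP r0] := @poly_ivt _ p (- M) M.
  - by lra.
  - have := ler_norm c; have := ler_norm (- c); rewrite normrN => ? ?.
    rewrite !pE (_ : (- M) ^+ 3 = - M ^+ 3); last by ring.
    apply/andP; split; lra.
  by exists r; apply/eqP; rewrite -subr_eq0 -pE r0.
have r0 : r != 0.
  by apply: contraTneq (invr_neq0 dg0) => r0; rewrite -/c -r3 r0 expr0n eqxx.
exists (r *: g); first by rewrite detZ r3 mulVf.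
move=> x; apply/esym.
have urg : r *: g \in unitmx by rewrite unitmxZ // unitfE.
rewrite -[RHS](mulmxK urg) /Ad mulmxKV //.
rewrite -(mulmxK urg (_ *m invmx g)); congr (_ *m _).
by rewrite -!scalemxAr mulmxKV // scalemxAl.
Qed.

(** * The three models *)

Section Basis5.
Variables (F : fieldType) (V : vectType F).

Lemma span5P (x1 x2 x3 x4 x5 w : V) :
  reflect (exists a b c d k, w = a *: x1 + b *: x2 + c *: x3 + d *: x4 + k *: x5)
    (w \in <<[:: x1; x2; x3; x4; x5]>>%VS).
Proof.
rewrite -[[:: _; _; _; _; _]]/([:: x1; x2] ++ [:: x3; x4; x5]) span_cat.
rewrite (span_cons x1) span_seq1.
apply: (iffP memv_addP) => [[_ /memv_addP[_ /vlineP[a ->] [_ /vlineP[b ->] ->]]]|].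
  move=> [_ /span3P[c [d [k ->]]] ->].
  by exists a, b, c, d, k; rewrite !addrA.
move=> [a [b [c [d [k ->]]]]]; exists (a *: x1 + b *: x2).
  by apply: memv_add; rewrite memvZ ?memv_line.
exists (c *: x3 + d *: x4 + k *: x5); last by rewrite !addrA.
by apply/span3P; exists c, d, k.
Qed.

Lemma free5 (x1 x2 x3 x4 x5 : V) :
  (forall a b c d k, a *: x1 + b *: x2 + c *: x3 + d *: x4 + k *: x5 = 0 ->
    [/\ a = 0, b = 0, c = 0, d = 0 & k = 0]) ->
  free [:: x1; x2; x3; x4; x5].
Proof.
move=> ind; rewrite -[X in free X]/(tval [tuple x1; x2; x3; x4; x5]); apply/freeP=> k.
rewrite !big_ord_recl big_ord0 /= addr0 !addrA => /ind [k0 k1 k2 k3 k4].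
case=> [[|[|[|[|[|//]]]]] lt];
  [rewrite -[RHS]k0|rewrite -[RHS]k1|rewrite -[RHS]k2|rewrite -[RHS]k3|rewrite -[RHS]k4];
  by congr (k _); apply/val_inj.
Qed.

End Basis5.

Section Models.
Variable F : fieldType.
Implicit Types x y : 'M[F]_3.

Lemma eE :
  (e F 1 = mx3 0 1 0 0 0 0 0 0 0) * (e F 2 = mx3 0 0 1 0 0 0 0 0 0) *
  (e F 3 = mx3 0 0 0 1 0 0 0 0 0) * (e F 4 = mx3 0 0 0 0 0 0 1 0 0) *
  (e F 5 = mx3 (-1) 0 0 0 1 0 0 0 0) * (e F 6 = mx3 0 0 0 0 0 1 0 0 0) *
  (e F 7 = mx3 0 0 0 0 0 0 0 1 0) * (e F 8 = mx3 (-1) 0 0 0 0 0 0 0 1).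
Proof. by do !split; rewrite /e sl3_mxE; congr mx3; rewrite /=; ring. Qed.

Lemma mem_slP x : reflect (exists a b c d f g h k, x = mx3 (- a - k) b c d a f g h k)
  (x \in sl F 3).
Proof.
rewrite memv_sl; apply: (iffP eqP) => [|[a [b [c [d [f [g [h [k ->]]]]]]]]].
  have [p [b [c [d [a [f [g [h [k ->]]]]]]]]] := mx3_eta x.
  rewrite tr_mx3 => E; exists a, b, c, d, f, g, h, k; congr mx3.
  by rewrite -[RHS]add0r -E; ring.
by rewrite tr_mx3; ring.
Qed.

Lemma h6P x : reflect (exists a b c, x = mx3 0 a b (- a) 0 (- c) (- b) c 0) (x \in h6 F).
Proof.
apply: (iffP (span3P _ _ _ _)) => -[a [b [c ->]]]; exists a, b, c;
  by rewrite !eE !mx3E; congr mx3; ring.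
Qed.

Lemma h7P x : reflect (exists a b c, x = mx3 0 a b a 0 c b (- c) 0) (x \in h7 F).
Proof.
apply: (iffP (span3P _ _ _ _)) => -[a [b [c ->]]]; exists a, b, c;
  by rewrite !eE !mx3E; congr mx3; ring.
Qed.

Lemma h8P x : reflect (exists a b c, x = mx3 0 0 0 0 a b 0 c (- a)) (x \in h8 F).
Proof.
apply: (iffP (span3P _ _ _ _)) => -[a [b [c ->]]]; exists a, b, c;
  by rewrite !eE !mx3E; congr mx3; ring.
Qed.

Lemma m6P x : reflect (exists a b c d k, x = mx3 (- a - b) c d c a k d k b) (x \in m6 F).
Proof.
apply: (iffP (span5P _ _ _ _ _ _)) => -[a [b [c [d [k ->]]]]]; exists a, b, c, d, k;
  by rewrite !eE !mx3E; congr mx3; ring.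
Qed.

Lemma m7P x : reflect (exists a b c d k, x = mx3 (- a - b) c d (- c) a k (- d) k b)
  (x \in m7 F).
Proof.
apply: (iffP (span5P _ _ _ _ _ _)) => -[a [b [c [d [k ->]]]]]; exists a, b, c, d, k;
  by rewrite !eE !mx3E; congr mx3; ring.
Qed.

Lemma m8P x : reflect (exists a b c d k, x = mx3 (- k - k) a b c k 0 d 0 k) (x \in m8 F).
Proof.
apply: (iffP (span5P _ _ _ _ _ _)) => -[a [b [c [d [k ->]]]]]; exists a, b, c, d, k;
  by rewrite !eE !mx3E; congr mx3; ring.
Qed.

End Models.


Lemma reductive_pairI (F : fieldType) n (s h m : {vspace 'M[F]_n}) :
  lie_subalgebra h -> {subset h <= s} -> {subset m <= s} ->
  (forall x, x \in s -> exists2 y, y \in h & x - y \in m) ->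
  (forall x, x \in h -> x \in m -> x = 0) ->
  (forall x y, x \in h -> y \in m -> [lie x, y] \in m) -> reductive_pair s h m.
Proof.
move=> sub hs ms dec dis inv; split=> //.
  apply/eqP; rewrite eqEsubv subv_add; apply/andP; split.
    by apply/andP; split; apply/subvP.
  apply/subvP=> x /dec[y yh xy].
  by rewrite -(subrK y x) memv_add.
apply/eqP; rewrite -subv0; apply/subvP=> x /memv_capP[xm xh].
by rewrite (dis x) ?mem0v.
Qed.

Section RealModels.
Variable R : realFieldType.

Lemma dim_h6 : \dim (h6 R) = 3%N.
Proof.
apply/eqP; apply: indep3_free => a b c; rewrite !eE !mx3E => /mx3_inj E.
by split; lra.
Qed.

Lemma dim_h7 : \dim (h7 R) = 3%N.
Proof.
apply/eqP; apply: indep3_free => a b c; rewrite !eE !mx3E => /mx3_inj E.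
by split; lra.
Qed.

Lemma dim_h8 : \dim (h8 R) = 3%N.
Proof.
apply/eqP; apply: indep3_free => a b c; rewrite !eE !mx3E => /mx3_inj E.
by split; lra.
Qed.

Lemma dim_m6 : \dim (m6 R) = 5%N.
Proof.
apply/eqP; apply: free5 => a b c d k; rewrite !eE !mx3E => /mx3_inj E.
by split; lra.
Qed.

Lemma dim_m7 : \dim (m7 R) = 5%N.
Proof.
apply/eqP; apply: free5 => a b c d k; rewrite !eE !mx3E => /mx3_inj E.
by split; lra.
Qed.

Lemma dim_m8 : \dim (m8 R) = 5%N.
Proof.
apply/eqP; apply: free5 => a b c d k; rewrite !eE !mx3E => /mx3_inj E.
by split; lra.
Qed.

Lemma reductive6 : reductive_pair (sl R 3) (h6 R) (m6 R).
Proof.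
apply: reductive_pairI.
- move=> _ _ /h6P[a [b [c ->]]] /h6P[a' [b' [c' ->]]]; apply/h6P.
  exists (b * c' - b' * c), (a' * c - a * c'), (a * b' - a' * b).
  by rewrite /lie_bracket !mx3E; congr mx3; ring.
- by move=> _ /h6P[a [b [c ->]]]; rewrite memv_sl tr_mx3; apply/eqP; ring.
- by move=> _ /m6P[a [b [c [d [k ->]]]]]; rewrite memv_sl tr_mx3; apply/eqP; ring.
- move=> _ /mem_slP[a [b [c [d [f [g [h [k ->]]]]]]]].
  exists (mx3 0 ((b - d) / 2) ((c - g) / 2) (- ((b - d) / 2)) 0 (- ((h - f) / 2))
              (- ((c - g) / 2)) ((h - f) / 2) 0); first by apply/h6P; do 3!eexists.
  apply/m6P; exists a, k, ((b + d) / 2), ((c + g) / 2), ((f + h) / 2).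
  by rewrite !mx3E; congr mx3; field.
- move=> _ /h6P[a [b [c ->]]] /m6P[a' [b' [c' [d' [k']]]]] /mx3_inj E.
  by rewrite zero_mx3; congr mx3; lra.
move=> _ _ /h6P[a [b [c ->]]] /m6P[a' [b' [c' [d' [k' ->]]]]]; apply/m6P.
exists (- 2 * a * c' - 2 * c * k'), (- 2 * b * d' + 2 * c * k').
exists (2 * a * a' + b * k' + a * b' - c * d'), (a * k' + 2 * b * b' + a' * b + c * c').
exists (- a * d' - b' * c - b * c' + a' * c).
by rewrite /lie_bracket !mx3E; congr mx3; ring.
Qed.

Lemma reductive7 : reductive_pair (sl R 3) (h7 R) (m7 R).
Proof.
apply: reductive_pairI.
- move=> _ _ /h7P[a [b [c ->]]] /h7P[a' [b' [c' ->]]]; apply/h7P.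
  exists (- b * c' + b' * c), (a * c' - a' * c), (a * b' - a' * b).
  by rewrite /lie_bracket !mx3E; congr mx3; ring.
- by move=> _ /h7P[a [b [c ->]]]; rewrite memv_sl tr_mx3; apply/eqP; ring.
- by move=> _ /m7P[a [b [c [d [k ->]]]]]; rewrite memv_sl tr_mx3; apply/eqP; ring.
- move=> _ /mem_slP[a [b [c [d [f [g [h [k ->]]]]]]]].
  exists (mx3 0 ((b + d) / 2) ((c + g) / 2) ((b + d) / 2) 0 ((f - h) / 2)
              ((c + g) / 2) (- ((f - h) / 2)) 0); first by apply/h7P; do 3!eexists.
  apply/m7P; exists a, k, ((b - d) / 2), ((c - g) / 2), ((f + h) / 2).
  by rewrite !mx3E; congr mx3; field.
- move=> _ /h7P[a [b [c ->]]] /m7P[a' [b' [c' [d' [k']]]]] /mx3_inj E.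
  by rewrite zero_mx3; congr mx3; lra.
move=> _ _ /h7P[a [b [c ->]]] /m7P[a' [b' [c' [d' [k' ->]]]]]; apply/m7P.
exists (2 * a * c' + 2 * c * k'), (2 * b * d' - 2 * c * k').
exists (2 * a * a' + b * k' + a * b' + c * d'), (a * k' + 2 * b * b' + a' * b - c * c').
exists (a * d' + b' * c + b * c' - a' * c).
by rewrite /lie_bracket !mx3E; congr mx3; ring.
Qed.

Lemma reductive8 : reductive_pair (sl R 3) (h8 R) (m8 R).
Proof.
apply: reductive_pairI.
- move=> _ _ /h8P[a [b [c ->]]] /h8P[a' [b' [c' ->]]]; apply/h8P.
  exists (b * c' - b' * c), (2 * a * b' - 2 * a' * b), (2 * a' * c - 2 * a * c').
  by rewrite /lie_bracket !mx3E; congr mx3; ring.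
- by move=> _ /h8P[a [b [c ->]]]; rewrite memv_sl tr_mx3; apply/eqP; ring.
- by move=> _ /m8P[a [b [c [d [k ->]]]]]; rewrite memv_sl tr_mx3; apply/eqP; ring.
- move=> _ /mem_slP[a [b [c [d [f [g [h [k ->]]]]]]]].
  exists (mx3 0 0 0 0 ((a - k) / 2) f 0 h (- ((a - k) / 2))).
    by apply/h8P; do 3!eexists.
  apply/m8P; exists b, c, d, g, ((a + k) / 2).
  by rewrite !mx3E; congr mx3; field.
- move=> _ /h8P[a [b [c ->]]] /m8P[a' [b' [c' [d' [k']]]]] /mx3_inj E.
  by rewrite zero_mx3; congr mx3; lra.
move=> _ _ /h8P[a [b [c ->]]] /m8P[a' [b' [c' [d' [k' ->]]]]]; apply/m8P.
exists (- a * a' - b' * c), (- a' * b + a * b'), (a * c' + b * d'), (c * c' - a * d'), 0.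
by rewrite /lie_bracket !mx3E; congr mx3; ring.
Qed.

(** As [m + h] is the whole algebra, only [h] remains to be reached from [m]. *)
Lemma generates_of_sub n (s h m : {vspace 'M[R]_n}) : reductive_pair s h m ->
  (forall k, lie_subalgebra k -> (m <= k)%VS -> (h <= k)%VS) -> lie_generates m s.
Proof.
move=> red H; split; first by have [] := reductive_sub red.
by case: (red) => _ <- _ _ k sk mk; rewrite subv_add mk H.
Qed.

Lemma generates6 : lie_generates (m6 R) (sl R 3).
Proof.
apply: (generates_of_sub reductive6) => k sk /subvP mk.
have k5 : e R 5 \in k by rewrite mk // memv_span // !inE eqxx ?orbT.
have k8 : e R 8 \in k by rewrite mk // memv_span // !inE eqxx ?orbT.
have k1 : e R 1 + e R 3 \in k by rewrite mk // memv_span // !inE eqxx ?orbT.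
have k2 : e R 2 + e R 4 \in k by rewrite mk // memv_span // !inE eqxx ?orbT.
have k7 : e R 7 + e R 6 \in k by rewrite mk // memv_span // !inE eqxx ?orbT.
apply/span_subvP=> x; rewrite !inE => /or3P[] /eqP->.
- have -> : e R 1 - e R 3 = - 2^-1 *: [lie e R 5, e R 1 + e R 3].
    by rewrite /lie_bracket !eE !mx3E; congr mx3; field.
  by rewrite memvZ // sk.
- have -> : e R 2 - e R 4 = - 2^-1 *: [lie e R 8, e R 2 + e R 4].
    by rewrite /lie_bracket !eE !mx3E; congr mx3; field.
  by rewrite memvZ // sk.
have -> : e R 7 - e R 6 = - [lie e R 5, e R 7 + e R 6].
  by rewrite /lie_bracket !eE !mx3E; congr mx3; ring.
by rewrite memvN sk.
Qed.

Lemma generates7 : lie_generates (m7 R) (sl R 3).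
Proof.
apply: (generates_of_sub reductive7) => k sk /subvP mk.
have k5 : e R 5 \in k by rewrite mk // memv_span // !inE eqxx ?orbT.
have k8 : e R 8 \in k by rewrite mk // memv_span // !inE eqxx ?orbT.
have k1 : e R 1 - e R 3 \in k by rewrite mk // memv_span // !inE eqxx ?orbT.
have k2 : e R 2 - e R 4 \in k by rewrite mk // memv_span // !inE eqxx ?orbT.
have k7 : e R 7 + e R 6 \in k by rewrite mk // memv_span // !inE eqxx ?orbT.
apply/span_subvP=> x; rewrite !inE => /or3P[] /eqP->.
- have -> : e R 1 + e R 3 = - 2^-1 *: [lie e R 5, e R 1 - e R 3].
    by rewrite /lie_bracket !eE !mx3E; congr mx3; field.
  by rewrite memvZ // sk.
- have -> : e R 2 + e R 4 = - 2^-1 *: [lie e R 8, e R 2 - e R 4].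
    by rewrite /lie_bracket !eE !mx3E; congr mx3; field.
  by rewrite memvZ // sk.
have -> : e R 6 - e R 7 = [lie e R 5, e R 7 + e R 6].
  by rewrite /lie_bracket !eE !mx3E; congr mx3; ring.
by rewrite sk.
Qed.

Lemma generates8 : lie_generates (m8 R) (sl R 3).
Proof.
apply: (generates_of_sub reductive8) => k sk /subvP mk.
have k1 : e R 1 \in k by rewrite mk // memv_span // !inE eqxx ?orbT.
have k2 : e R 2 \in k by rewrite mk // memv_span // !inE eqxx ?orbT.
have k3 : e R 3 \in k by rewrite mk // memv_span // !inE eqxx ?orbT.
have k4 : e R 4 \in k by rewrite mk // memv_span // !inE eqxx ?orbT.
apply/span_subvP=> x; rewrite !inE => /or3P[] /eqP->.
- have -> : e R 5 - e R 8 = [lie e R 2, e R 4] - [lie e R 1, e R 3].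
    by rewrite /lie_bracket !eE !mx3E; congr mx3; ring.
  by rewrite memvB // sk.
- have -> : e R 6 = [lie e R 3, e R 2].
    by rewrite /lie_bracket !eE !mx3E; congr mx3; ring.
  by rewrite sk.
have -> : e R 7 = [lie e R 4, e R 1].
  by rewrite /lie_bracket !eE !mx3E; congr mx3; ring.
by rewrite sk.
Qed.

Lemma complement_eq n (s h m m' : {vspace 'M[R]_n}) :
  reductive_pair s h m -> reductive_pair s h m' -> (m' <= m)%VS -> m = m'.
Proof.
move=> [_ E D _] [_ E' D' _] mm; apply/esym/eqP; rewrite eqEdim mm /=.
by rewrite -(leq_add2r (\dim h)) -!dimv_disjoint_sum // E E'.
Qed.

(** The eigenvalues of the Casimir operator are -2 on [h6], the representation of
    spin 1, and -6 on [m6], the representation of spin 2. *)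
Lemma complement6 m : reductive_pair (sl R 3) (h6 R) m -> m = m6 R.
Proof.
move=> red; apply: (complement_eq red reductive6); apply/span_subvP=> x xm.
pose X := e R 1 - e R 3; pose Y := e R 2 - e R 4; pose Z := e R 7 - e R 6.
have [X6 Y6 Z6] : [/\ X \in h6 R, Y \in h6 R & Z \in h6 R].
  by split; rewrite memv_span // !inE eqxx ?orbT.
apply: (@casimir_mem _ _ _ _ _ red X X Y Y Z Z (- 2) (- 6)).
- by apply/allP; rewrite /= X6 Y6 Z6.
- move=> _ /h6P[a [b [c ->]]]; rewrite /lie_bracket /X /Y /Z !eE !mx3E.
  by congr mx3; ring.
- have /m6P[a [b [c [d [k ->]]]]] : x \in m6 R by exact: memv_span.
  by rewrite /lie_bracket /X /Y /Z !eE !mx3E; congr mx3; ring.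
- by apply/eqP; lra.
by have [_ /subvP] := reductive_sub reductive6; apply; exact: memv_span.
Qed.

(** As for [h6], but the Casimir operator is normalized with the signs of the
    invariant form of [h7]. *)
Lemma complement7 m : reductive_pair (sl R 3) (h7 R) m -> m = m7 R.
Proof.
move=> red; apply: (complement_eq red reductive7); apply/span_subvP=> x xm.
pose X := e R 1 + e R 3; pose Y := e R 2 + e R 4; pose Z := e R 6 - e R 7.
have [X7 Y7 Z7] : [/\ X \in h7 R, Y \in h7 R & Z \in h7 R].
  by split; rewrite memv_span // !inE eqxx ?orbT.
apply: (@casimir_mem _ _ _ _ _ red X X Y Y Z (- Z) 2 6).
- by apply/allP; rewrite /= memvN X7 Y7 Z7.
- move=> _ /h7P[a [b [c ->]]]; rewrite /lie_bracket /X /Y /Z !eE !mx3E.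
  by congr mx3; ring.
- have /m7P[a [b [c [d [k ->]]]]] : x \in m7 R by exact: memv_span.
  by rewrite /lie_bracket /X /Y /Z !eE !mx3E; congr mx3; ring.
- by apply/eqP; lra.
by have [_ /subvP] := reductive_sub reductive7; apply; exact: memv_span.
Qed.

(** [m8] is the sum of two representations of dimension 2 and a trivial one, with
    Casimir eigenvalues 3, 3 and 0, against 8 on [h8]. *)
Lemma complement8 m : reductive_pair (sl R 3) (h8 R) m -> m = m8 R.
Proof.
move=> red; apply: (complement_eq red reductive8); apply/span_subvP=> x xm.
pose T := e R 5 - e R 8; pose Z := e R 6; pose U := e R 7.
have [T8 Z8 U8] : [/\ T \in h8 R, Z \in h8 R & U \in h8 R].
  by split; rewrite memv_span // !inE eqxx ?orbT.
have [k Dx k8] : exists2 k : R, [lie T, [lie T, x]] + [lie Z, [lie 2 *: U, x]] +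
    [lie U, [lie 2 *: Z, x]] = k *: x & 8 != k.
  move: xm; rewrite !inE => /orP[/eqP->|/or4P[] /eqP->];
    [exists 3|exists 3|exists 3|exists 3|exists 0]; rewrite ?(eqr_nat, pnatr_eq0) //;
    by rewrite /lie_bracket /T /Z /U !eE !mx3E; congr mx3; ring.
apply: (@casimir_mem _ _ _ _ _ red T T Z (2 *: U) U (2 *: Z) 8 k) => //.
- by apply/allP; rewrite /= !memvZ // T8 Z8 U8.
- move=> _ /h8P[a [b [c ->]]]; rewrite /lie_bracket /T /Z /U !eE !mx3E.
  by congr mx3; ring.
by have [_ /subvP] := reductive_sub reductive8; apply; exact: memv_span.
Qed.

End RealModels.

(** * Classification and mutual exclusion *)

Section Classification.
Variable R : rcfType.
Implicit Types (h m : {vspace 'M[R]_3}).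

Lemma AdV_span3 (g a b c : 'M[R]_3) h : g \in unitmx -> indep3 a b c -> \dim h = 3%N ->
  Ad g a \in h -> Ad g b \in h -> Ad g c \in h -> AdV g <<[:: a; b; c]>> = h.
Proof.
move=> ug ind dh ha hb hc; apply/eqP.
have /eqP dabc := indep3_free ind.
rewrite eqEdim dim_AdV // dabc dh leqnn andbT limg_span /= !lfunE /=.
by apply/span_subvP=> x; rewrite !inE => /or3P[] /eqP->.
Qed.

Lemma indep3_reg : indep3 (regZ R) (regT R) (regU R).
Proof.
by move=> a b c; rewrite /regZ /regT /regU !mx3E => /mx3_inj E; split; lra.
Qed.

Lemma indep3_min : indep3 (minZ R) (minT R) (minU R).
Proof.
by move=> a b c; rewrite /minZ /minT /minU !mx3E => /mx3_inj E; split; lra.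
Qed.

(** [h7] preserves the form with matrix diag (-1, 1, 1).  The matrix [t] below has
    eigenvalues 2, 0, -2 and [z] spans the highest root space for it. *)
Lemma reg_conj_h7 : exists2 g, g \in unitmx &
  AdV g <<[:: regZ R; regT R; regU R]>> = h7 R.
Proof.
pose z : 'M[R]_3 := mx3 0 0 1 0 0 1 1 (-1) 0.
pose t : 'M[R]_3 := mx3 0 2 0 2 0 0 0 0 0.
pose u : 'M[R]_3 := mx3 0 0 1 0 0 (-1) 1 1 0.
have ztu : sl2_triple z t u.
  by split; rewrite /lie_bracket /z /t /u !mx3E; congr mx3; ring.
have z2 : z *m z != 0.
  by apply/eqP; rewrite /z !mx3E => /mx3_inj E; lra.
have [g ug [gz gt gu]] := sl2_triple_normal_reg ztu z2.
exists g => //; apply: AdV_span3 => //; first exact: indep3_reg.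
- exact: dim_h7.
- by rewrite gz; apply/h7P; exists 0, 1, 1; rewrite /z; congr mx3; ring.
- by rewrite gt; apply/h7P; exists 2, 0, 0; rewrite /t; congr mx3; ring.
by rewrite gu; apply/h7P; exists 0, 1, (-1); rewrite /u; congr mx3; ring.
Qed.

Lemma min_conj_h8 : exists2 g, g \in unitmx &
  AdV g <<[:: minZ R; minT R; minU R]>> = h8 R.
Proof.
pose z : 'M[R]_3 := mx3 0 0 0 0 0 1 0 0 0.
pose t : 'M[R]_3 := mx3 0 0 0 0 1 0 0 0 (-1).
pose u : 'M[R]_3 := mx3 0 0 0 0 0 0 0 1 0.
have ztu : sl2_triple z t u.
  by split; rewrite /lie_bracket /z /t /u !mx3E; congr mx3; ring.
have z0 : z != 0 by apply/eqP; rewrite /z zero_mx3 => /mx3_inj E; lra.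
have z2 : z *m z = 0 by rewrite /z !mx3E; congr mx3; ring.
have [g ug [gz gt gu]] := sl2_triple_normal_min ztu z2 z0.
exists g => //; apply: AdV_span3 => //; first exact: indep3_min.
- exact: dim_h8.
- by rewrite gz; apply/h8P; exists 0, 1, 0; rewrite /z; congr mx3; ring.
- by rewrite gt; apply/h8P; exists 1, 0, 0; rewrite /t; congr mx3; ring.
by rewrite gu; apply/h8P; exists 0, 0, 1; rewrite /u; congr mx3; ring.
Qed.

Lemma so3_conj_h6 h (a b c : 'M[R]_3) : \dim h = 3%N ->
  a \in h -> b \in h -> c \in h -> so3_triple a b c -> a *m a *m a != 0 ->
  exists2 g, g \in unitmx & AdV g (h6 R) = h.
Proof.
move=> dh ha hb hc abc a3; have [g ug [ga gb gc]] := so3_normal_form abc a3.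
exists g => //.
pose A : 'M[R]_3 := mx3 0 0 0 0 0 (-1) 0 1 0.
pose B : 'M[R]_3 := mx3 0 (-1) 0 1 0 0 0 0 0.
pose C : 'M[R]_3 := mx3 0 0 (-1) 0 0 0 1 0 0.
have -> : h6 R = <<[:: A; B; C]>>%VS.
  apply/vspaceP=> x; apply/h6P/span3P => -[p [q [r ->]]].
    by exists r, (- p), (- q); rewrite !mx3E; congr mx3; ring.
  by exists (- q), (- r), p; rewrite !mx3E; congr mx3; ring.
apply: AdV_span3; rewrite ?ga ?gb ?gc //.
by move=> p q r; rewrite !mx3E => /mx3_inj E; split; lra.
Qed.

Lemma classification_GL h m : reductive_pair (sl R 3) h m -> \dim h = 3%N ->
  exists2 g, g \in unitmx & [\/ AdV g h = h6 R, AdV g h = h7 R | AdV g h = h8 R].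
Proof.
move=> red dh; have [hsl _] := reductive_sub red.
have sub : lie_subalgebra h by case: red.
have [nf|N] := pselect (nilpotent_free h).
  have [a [b [c [ha hb hc a0 abc]]]] := exists_so3_triple hsl dh sub nf.
  have a3 : a *m a *m a != 0 by apply: contraNneq a0 => /(nf _ ha) ->.
  have [g ug gh] := so3_conj_h6 dh ha hb hc abc a3.
  exists (invmx g); first by rewrite unitmx_inv.
  by constructor 1; rewrite -gh AdVVK.
have [z [hz z3 z0]] : exists z, [/\ z \in h, z *m z *m z = 0 & z != 0].
  apply: contrapT => N'; apply: N => z hz z3; apply/eqP/negPn/negP => z0.
  by apply: N'; exists z.
have [t [u [ht hu ztu]]] := reductive_triple red dh hz z0 z3.
have [z2|z2] := eqVneq (z *m z) 0.
  have [g ug [gz gt gu]] := sl2_triple_normal_min ztu z2 z0.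
  have [g8 ug8 gh8] := min_conj_h8.
  exists (g8 *m invmx g); first by rewrite unitmx_mul ug8 unitmx_inv.
  constructor 3; rewrite -AdV_comp ?unitmx_inv // -gh8; congr (_ @: _)%VS.
  by rewrite -(AdV_span3 ug indep3_min dh) ?gz ?gt ?gu // AdVVK.
have [g ug [gz gt gu]] := sl2_triple_normal_reg ztu z2.
have [g7 ug7 gh7] := reg_conj_h7.
exists (g7 *m invmx g); first by rewrite unitmx_mul ug7 unitmx_inv.
constructor 2; rewrite -AdV_comp ?unitmx_inv // -gh7; congr (_ @: _)%VS.
by rewrite -(AdV_span3 ug indep3_reg dh) ?gz ?gt ?gu // AdVVK.
Qed.

Lemma classification h m : reductive_pair (sl R 3) h m -> \dim h = 3%N ->
  [\/ SL_conjugate h m (h6 R) (m6 R), SL_conjugate h m (h7 R) (m7 R)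
    | SL_conjugate h m (h8 R) (m8 R)].
Proof.
move=> red dh; have [g ug] := classification_GL red dh.
have [g' dg' gg'] := SL_of_GL ug.
have ug' : g' \in unitmx by rewrite unitmxE dg' unitr1.
have <- : AdV g' h = AdV g h by apply: eq_in_limg => x _; rewrite !lfunE /= gg'.
have red' := AdV_reductive ug' red.
case=> gh; rewrite gh in red';
  [constructor 1 | constructor 2 | constructor 3]; exists g'; split=> //;
  [exact: complement6 | exact: complement7 | exact: complement8].
Qed.

Lemma SL_conjugate_back (h m h' m' : {vspace 'M[R]_3}) :
  SL_conjugate h m h' m' -> reductive_pair (sl R 3) h' m' ->
  lie_generates m' (sl R 3) ->
  [/\ reductive_pair (sl R 3) h m, \dim h = \dim h', \dim m = \dim m'
    & lie_generates m (sl R 3)].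
Proof.
move=> [g [dg <- <-]].
have ug : g \in unitmx by rewrite unitmxE dg unitr1.
have ug' : invmx g \in unitmx by rewrite unitmx_inv.
move=> /(AdV_reductive ug') red /(AdV_generates ug') gen.
by move: red gen; rewrite !AdVVK // !dim_AdV.
Qed.

End Classification.

Section Exclusion.
Variable R : realFieldType.

Definition has_square_zero (h : {vspace 'M[R]_3}) :=
  exists x, [/\ x \in h, x != 0 & x *m x = 0].
Definition has_positive_square (h : {vspace 'M[R]_3}) :=
  exists2 x, x \in h & 0 < \tr (x *m x).

Lemma square_zero_Ad g h : g \in unitmx -> has_square_zero h <-> has_square_zero (AdV g h).
Proof.
have imp g' h' : g' \in unitmx -> has_square_zero h' -> has_square_zero (AdV g' h').
  move=> ug [x [xh x0 x2]]; exists (Ad g' x); split.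
  - by rewrite memv_Ad // AdVK.
  - by apply: contraNneq x0 => E; rewrite -(AdVK x ug) E linear0.
  - by rewrite -Ad_mul // x2 linear0.
move=> ug; split; first exact: imp.
by move/(imp (invmx g)); rewrite AdVVK // unitmx_inv; apply.
Qed.

Lemma positive_square_Ad g h : g \in unitmx ->
  has_positive_square h <-> has_positive_square (AdV g h).
Proof.
have imp g' h' : g' \in unitmx -> has_positive_square h' -> has_positive_square (AdV g' h').
  move=> ug [x xh x2]; exists (Ad g' x); first by rewrite memv_Ad // AdVK.
  by rewrite -Ad_mul // tr_Ad.
move=> ug; split; first exact: imp.
by move/(imp (invmx g)); rewrite AdVVK // unitmx_inv; apply.
Qed.

Lemma square_zero_h6 : ~ has_square_zero (h6 R).
Proof.
move=> [x [/h6P[a [b [c ->]]] /eqP x0 x2]]; apply: x0; move: x2.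
rewrite !mx3E => /mx3_inj E.
have a2 : a ^+ 2 = 0 by have := sqr_ge0 a; have := sqr_ge0 b; lra.
have b2 : b ^+ 2 = 0 by have := sqr_ge0 a; have := sqr_ge0 b; lra.
have c2 : c ^+ 2 = 0 by have := sqr_ge0 a; have := sqr_ge0 c; lra.
move/eqP: a2; move/eqP: b2; move/eqP: c2; rewrite !sqrf_eq0 => /eqP-> /eqP-> /eqP->.
by rewrite oppr0.
Qed.

Lemma square_zero_h7 : ~ has_square_zero (h7 R).
Proof.
move=> [x [/h7P[a [b [c ->]]] /eqP x0 x2]]; apply: x0; move: x2.
rewrite !mx3E => /mx3_inj E.
have a2 : a ^+ 2 = 0 by have := sqr_ge0 a; have := sqr_ge0 b; lra.
have b2 : b ^+ 2 = 0 by have := sqr_ge0 a; have := sqr_ge0 b; lra.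
have c2 : c ^+ 2 = 0 by lra.
move/eqP: a2; move/eqP: b2; move/eqP: c2; rewrite !sqrf_eq0 => /eqP-> /eqP-> /eqP->.
by rewrite oppr0.
Qed.

Lemma square_zero_h8 : has_square_zero (h8 R).
Proof.
exists (mx3 0 0 0 0 0 1 0 0 0); split.
- by apply/h8P; exists 0, 1, 0; congr mx3; ring.
- by apply/eqP; rewrite zero_mx3 => /mx3_inj E; lra.
by rewrite !mx3E; congr mx3; ring.
Qed.

Lemma positive_square_h6 : ~ has_positive_square (h6 R).
Proof.
move=> [_ /h6P[a [b [c ->]]]]; rewrite !mx3E.
by have := sqr_ge0 a; have := sqr_ge0 b; have := sqr_ge0 c; lra.
Qed.

Lemma positive_square_h7 : has_positive_square (h7 R).
Proof.
exists (mx3 0 1 0 1 0 0 0 0 0); last by rewrite !mx3E; lra.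
by apply/h7P; exists 1, 0, 0; congr mx3; ring.
Qed.

(** Transport the invariant [P] from one model to the other through [h]. *)
Lemma SL_conjugate_excl (P : {vspace 'M[R]_3} -> Prop) (h m h1 m1 h2 m2 : {vspace 'M[R]_3}) :
  (forall g h', g \in unitmx -> P h' <-> P (AdV g h')) -> ~ P h1 -> P h2 ->
  ~ (SL_conjugate h m h1 m1 /\ SL_conjugate h m h2 m2).
Proof.
move=> inv N1 P2 [[g [dg gh _]] [g' [dg' gh' _]]]; apply: N1.
by rewrite -gh -inv ?unitmxE ?dg ?unitr1 // (inv g') ?gh' // unitmxE dg' unitr1.
Qed.

End Exclusion.

(** * Isomorphism types *)

Section Mx2.
Variable F : fieldType.

Definition mx2 (a b c d : F) : 'M[F]_2 :=
  \matrix_(i, j) nth 0 (nth [::] [:: [:: a; b]; [:: c; d]] i) j.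

Lemma mx2_inj a b c d a' b' c' d' : mx2 a b c d = mx2 a' b' c' d' ->
  [/\ a = a', b = b', c = c' & d = d'].
Proof.
by move=> /matrixP E; move: (E 0 0) (E 0 1) (E 1 0) (E 1 1); rewrite !mxE.
Qed.

Lemma mul_mx2 a b c d a' b' c' d' : mx2 a b c d *m mx2 a' b' c' d' =
  mx2 (a * a' + b * c') (a * b' + b * d') (c * a' + d * c') (c * b' + d * d').
Proof.
apply/matrixP=> i j; rewrite !mxE !big_ord_recl big_ord0 !mxE /= addr0.
by case: i j => [[|[|//]] ?] [[|[|//]] ?].
Qed.

Lemma sub_mx2 a b c d a' b' c' d' : mx2 a b c d - mx2 a' b' c' d' =
  mx2 (a - a') (b - b') (c - c') (d - d').
Proof. by apply/matrixP=> i j; rewrite !mxE; case: i j => [[|[|//]] ?] [[|[|//]] ?]. Qed.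

Lemma zero_mx2 : 0 = mx2 0 0 0 0.
Proof. by apply/matrixP=> i j; rewrite !mxE; case: i j => [[|[|//]] ?] [[|[|//]] ?]. Qed.

Lemma mem_sl2P (y : 'M[F]_2) :
  reflect (exists a b c, y = mx2 a b c (- a)) (y \in sl F 2).
Proof.
rewrite memv_sl /mxtrace !big_ord_recl big_ord0 addr0.
apply: (iffP eqP) => [E|[a [b [c ->]]]]; last by rewrite !mxE /= subrr.
exists (y 0 0), (y 0 1), (y 1 0); apply/matrixP=> i j; rewrite !mxE.
have E1 : - y 0 0 = y 1 1.
  apply/eqP; rewrite eq_sym -addr_eq0 addrC; apply/eqP; rewrite -[RHS]E.
  by congr (y _ _ + y _ _); apply/val_inj.
by case: i j => [[|[|//]] ?] [[|[|//]] ?] /=; rewrite ?E1; congr (y _ _); apply/val_inj.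
Qed.

End Mx2.

Section Iso.
Variables (F : fieldType) (n p : nat).

Lemma lie_isomorphicI (h : {vspace 'M[F]_n}) (k : {vspace 'M[F]_p})
    (f : {linear 'M[F]_n -> 'M[F]_p}) :
  (forall x, x \in h -> f x \in k) ->
  (forall x, x \in h -> f x = 0 -> x = 0) ->
  (forall y, y \in k -> exists2 x, x \in h & f x = y) ->
  {in h &, forall x y, f [lie x, y] = [lie f x, f y]} -> lie_isomorphic h k.
Proof.
move=> fk inj surj mor; exists (linfun f); split.
- apply/eqP; rewrite -subv0; apply/subvP=> x /memv_capP[xh].
  by rewrite memv_ker lfunE /= => /eqP/(inj _ xh) ->; apply: mem0v.
- apply/eqP; rewrite eqEsubv; apply/andP; split; apply/subvP=> y.
    by move=> /memv_imgP[x xh ->]; rewrite lfunE; apply: fk.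
  by move=> /surj[x xh <-]; rewrite -(lfunE f) memv_img.
by move=> x y xh yh; rewrite !lfunE /= mor.
Qed.

End Iso.

Section Isomorphisms.
Variable R : realFieldType.

Lemma h6_so3 : h6 R = so R 3.
Proof.
apply/vspaceP=> x; rewrite memv_so; apply/h6P/eqP => [[a [b [c ->]]]|].
  by apply/matrixP=> i j; rewrite !mxE; case: i j => [[|[|[|//]]] ?] [[|[|[|//]]] ?] /=;
    rewrite ?oppr0 ?opprK.
have [a [b [c [d [f [g [h [k [l ->]]]]]]]]] := mx3_eta x.
have -> : (mx3 a b c d f g h k l)^T = mx3 a d h b f k c g l.
  by apply/matrixP=> i j; rewrite !mxE; case: i j => [[|[|[|//]]] ?] [[|[|[|//]]] ?].
rewrite !mx3E => /mx3_inj E; exists b, c, k; congr mx3; lra.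
Qed.

Lemma h6_iso : lie_isomorphic (h6 R) (so R 3).
Proof.
rewrite h6_so3; apply: (@lie_isomorphicI _ _ _ _ _ idfun) => // y ?; first by exists y.
Qed.

(** The inverse of the adjoint representation of sl(2), in orthogonal coordinates
    for its Killing form. *)
Definition so12_to_sl2 (x : 'M[R]_3) : 'M[R]_2 :=
  mx2 (x 0 1 / 2) ((x 0 ord_max + x 1 ord_max) / 2)
      ((x 0 ord_max - x 1 ord_max) / 2) (- (x 0 1 / 2)).

Lemma so12_to_sl2_is_linear : linear so12_to_sl2.
Proof.
move=> k x y; apply/matrixP=> i j; rewrite !mxE.
by case: i j => [[|[|//]] ?] [[|[|//]] ?] /=; ring.
Qed.

HB.instance Definition _ := GRing.isLinear.Build R 'M[R]_3 'M[R]_2 _ _ so12_to_sl2_is_linear.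

Lemma so12_to_sl2E a b c : so12_to_sl2 (mx3 0 a b a 0 c b (- c) 0) =
  mx2 (a / 2) ((b + c) / 2) ((b - c) / 2) (- (a / 2)).
Proof. by rewrite /so12_to_sl2 !mxE. Qed.

Lemma h7_iso : lie_isomorphic (h7 R) (sl R 2).
Proof.
apply: (@lie_isomorphicI _ _ _ _ _ so12_to_sl2).
- by move=> _ /h7P[a [b [c ->]]]; rewrite /= so12_to_sl2E; apply/mem_sl2P; do 3!eexists.
- move=> _ /h7P[a [b [c ->]]]; rewrite /= so12_to_sl2E zero_mx2 zero_mx3 => /mx2_inj[? ? ? ?].
  by congr mx3; lra.
- move=> _ /mem_sl2P[a [b [c ->]]].
  exists (mx3 0 (2 * a) (b + c) (2 * a) 0 (b - c) (b + c) (- (b - c)) 0).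
    by apply/h7P; do 3!eexists.
  by rewrite /= so12_to_sl2E; congr mx2; field.
move=> _ _ /h7P[a [b [c ->]]] /h7P[a' [b' [c' ->]]]; rewrite /= !so12_to_sl2E.
rewrite (_ : [lie _, _] = mx3 0 (b' * c - b * c') (a * c' - a' * c) (b' * c - b * c') 0
  (a * b' - a' * b) (a * c' - a' * c) (- (a * b' - a' * b)) 0); last first.
  by rewrite /lie_bracket !mx3E; congr mx3; ring.
by rewrite so12_to_sl2E /lie_bracket !mul_mx2 sub_mx2; congr mx2; field.
Qed.

Definition block_to_sl2 (x : 'M[R]_3) : 'M[R]_2 :=
  mx2 (x 1 1) (x 1 ord_max) (x ord_max 1) (x ord_max ord_max).

Lemma block_to_sl2_is_linear : linear block_to_sl2.
Proof.
by move=> k x y; apply/matrixP=> i j; rewrite !mxE; case: i j => [[|[|//]] ?] [[|[|//]] ?].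
Qed.

HB.instance Definition _ := GRing.isLinear.Build R 'M[R]_3 'M[R]_2 _ _ block_to_sl2_is_linear.

Lemma block_to_sl2E a b c d : block_to_sl2 (mx3 0 0 0 0 a b 0 c d) = mx2 a b c d.
Proof. by rewrite /block_to_sl2 !mxE. Qed.

Lemma h8_iso : lie_isomorphic (h8 R) (sl R 2).
Proof.
apply: (@lie_isomorphicI _ _ _ _ _ block_to_sl2).
- by move=> _ /h8P[a [b [c ->]]]; rewrite /= block_to_sl2E; apply/mem_sl2P; do 3!eexists.
- move=> _ /h8P[a [b [c ->]]]; rewrite /= block_to_sl2E zero_mx2 zero_mx3.
  by move=> /mx2_inj[-> -> -> _]; rewrite oppr0.
- move=> _ /mem_sl2P[a [b [c ->]]]; exists (mx3 0 0 0 0 a b 0 c (- a)).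
    by apply/h8P; do 3!eexists.
  by rewrite /= block_to_sl2E.
move=> _ _ /h8P[a [b [c ->]]] /h8P[a' [b' [c' ->]]]; rewrite /= !block_to_sl2E.
rewrite /lie_bracket !mul_mx2 sub_mx2 -block_to_sl2E !mx3E.
by congr (block_to_sl2 (mx3 _ _ _ _ _ _ _ _ _)); ring.
Qed.

End Isomorphisms.

Theorem proposition6 (R : realType) :
  [/\ (forall h m : {vspace 'M[R]_3},
         [/\ reductive_pair (sl R 3) h m, (\dim h = 3)%N, (\dim m = 5)%N
           & lie_generates m (sl R 3)]
         <-> [\/ SL_conjugate h m (h6 R) (m6 R),
                 SL_conjugate h m (h7 R) (m7 R)
               | SL_conjugate h m (h8 R) (m8 R)]),
      (forall h m : {vspace 'M[R]_3},
         [/\ ~ (SL_conjugate h m (h6 R) (m6 R) /\ SL_conjugate h m (h7 R) (m7 R)),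
             ~ (SL_conjugate h m (h6 R) (m6 R) /\ SL_conjugate h m (h8 R) (m8 R))
           & ~ (SL_conjugate h m (h7 R) (m7 R) /\ SL_conjugate h m (h8 R) (m8 R))]),
      lie_isomorphic (h6 R) (so R 3),
      lie_isomorphic (h7 R) (sl R 2)
    & lie_isomorphic (h8 R) (sl R 2)].
Proof.
split; [| | exact: h6_iso | exact: h7_iso | exact: h8_iso].
  move=> h m; split=> [[red dh _ _]|]; first exact: classification.
  case=> /SL_conjugate_back H.
  - have [red -> -> gen] := H (reductive6 R) (generates6 R).
    by split; rewrite ?dim_h6 ?dim_m6.
  - have [red -> -> gen] := H (reductive7 R) (generates7 R).
    by split; rewrite ?dim_h7 ?dim_m7.
  - have [red -> -> gen] := H (reductive8 R) (generates8 R).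
    by split; rewrite ?dim_h8 ?dim_m8.
move=> h m; split.
- apply: SL_conjugate_excl (@positive_square_Ad R) (@positive_square_h6 R) _.
  exact: positive_square_h7.
- apply: SL_conjugate_excl (@square_zero_Ad R) (@square_zero_h6 R) _.
  exact: square_zero_h8.
apply: SL_conjugate_excl (@square_zero_Ad R) (@square_zero_h7 R) _.
exact: square_zero_h8.
Qed.
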